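(* Let $0\le k\le n$ and let $\mathcal{F}^{\mathcal{G}}$ be a family of shape regular simplicial subdivisions of $\Omega$. There is a constant $C_{k,n}$, uniform for $\mathcal{F}^{\mathcal{G}}$, such that for every $\mathcal{G}_h\in\mathcal{F}^{\mathcal{G}}$ and every $\omega\in L^2\Lambda^k(\Omega)$ with $\omega|_T\in H\Lambda^k(T)$ for all $T\in\mathcal{G}_h$, $$\|\omega-\mathbb{I}^{d^k}_h\omega\|_{d^k_h}\le C_{k,n}\inf_{\eta_h\in\mathcal{P}_1^-\Lambda^k(\mathcal{G}_h)}\|\omega-\eta_h\|_{d^k_h}.$$
   Context: Let $n\ge 1$ and let $\Omega\subset\mathbb{R}^n$ be a bounded polyhedral domain. A family of simplicial subdivisions is shape regular if the ratio of diameter to inradius of all simplices is bounded uniformly over the family. $d^k$ is the exterior derivative on $k$-forms ($d^n=0$), $\star$ the Hodge star, and $\delta_k$ the codifferential on $k$-forms, i.e. the formal adjoint of $d^{k-1}$: $\langle d^{k-1}\mu,\eta\rangle_{L^2\Lambda^k}=\langle\mu,\delta_k\eta\rangle_{L^2\Lambda^{k-1}}$ whenever one of the smooth forms $\mu,\eta$ has compact support (thus $\delta_k=\pm\star d^{n-k}\star$). $H\Lambda^k(T)=\{\omega\in L^2\Lambda^k(T):d^k\omega\in L^2\Lambda^{k+1}(T)\}$, and $H\Lambda^n(T)=L^2\Lambda^n(T)$. $\mathcal{P}_0\Lambda^k$ denotes constant-coefficient $k$-forms. The Koszul operator is $\kappa(dx^{\alpha_1}\wedge\dots\wedge dx^{\alpha_k})=\sum_{j=1}^k(-1)^{j+1}x^{\alpha_j}dx^{\alpha_1}\wedge\dots\wedge\widehat{dx^{\alpha_j}}\wedge\dots\wedge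 dx^{\alpha_k}$; $\mathcal{P}_1^-\Lambda^k=\mathcal{P}_0\Lambda^k+\kappa(\mathcal{P}_0\Lambda^{k+1})$ and $\mathcal{P}_1^{*,-}\Lambda^k=\star(\mathcal{P}_1^-\Lambda^{n-k})$. $\mathcal{P}_1^-\Lambda^k(\mathcal{G}_h)$ is the space of forms whose restriction to each $T\in\mathcal{G}_h$ lies in $\mathcal{P}_1^-\Lambda^k(T)$ (no inter-element continuity). Local interpolator: for $0\le k\le n-1$, $\mathbb{I}^{d^k}_T:H\Lambda^k(T)\to\mathcal{P}_1^-\Lambda^k(T)$ is defined by $\langle\mathbb{I}^{d^k}_T\omega,\delta_{k+1}\eta\rangle_{L^2\Lambda^k(T)}-\langle d^k\mathbb{I}^{d^k}_T\omega,\eta\rangle_{L^2\Lambda^{k+1}(T)}=\langle\omega,\delta_{k+1}\eta\rangle_{L^2\Lambda^k(T)}-\langle d^k\omega,\eta\rangle_{L^2\Lambda^{k+1}(T)}$ for all $\eta\in\mathcal{P}_1^{*,-}\Lambda^{k+1}(T)$; $\mathbb{I}^{d^n}_T$ is the $L^2(T)$ projection onto $\mathcal{P}_0\Lambda^n(T)$. The global interpolator $\mathbb{I}^{d^k}_h$ is defined cell by cell: $(\mathbb{I}^{d^k}_h\omega)|_T=\mathbb{I}^{d^k}_T(\omega|_T)$. $d^k_h$ is $d^k$ applied cell by cell, and $\|\mu\|_{d^k_h}=(\|d^k_h\mu\|^2_{L^2\Lambda^{k+1}}+\|\mu\|^2_{L^2\Lambda^k})^{1/2}$. *)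

(* Defs.v *)
From HB Require Import structures.
From mathcomp Require Import all_boot all_order all_algebra finmap.
From mathcomp Require Import all_classical all_reals all_analysis.
Set Implicit Arguments.
Unset Strict Implicit.
Unset Printing Implicit Defensive.
Import Order.TTheory GRing.Theory Num.Theory.
Import numFieldNormedType.Exports.
Local Open Scope classical_set_scope.
Local Open Scope ring_scope.

(* Borel sigma-algebra of R^n = 'rV[R]_n, generated by the coordinates. *)
Section rV_measurable.
Context (R : realType) (n : nat).

Let coord (i : 'I_n) (x : 'rV[R]_n) : measurableTypeR R := x 0 i.

Let rV_set0 : g_sigma_preimage coord set0.
Proof. exact: sigma_algebra0. Qed.

Let rV_setC A : g_sigma_preimage coord A -> g_sigma_preimage coord (~` A).
Proof. exact: sigma_algebraC. Qed.

Let rV_bigcup (A : _^nat) : (forall i, g_sigma_preimage coord (A i)) ->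
  g_sigma_preimage coord (\bigcup_i (A i)).
Proof. exact: sigma_algebra_bigcup. Qed.

HB.instance Definition _ := @isMeasurable.Build default_measure_display
  'rV[R]_n (g_sigma_preimage coord) rV_set0 rV_setC rV_bigcup.

Lemma measurable_coord (i : 'I_n) : measurable_fun [set: 'rV[R]_n] (coord i).
Proof.
move=> _ Y mY; rewrite setTI; apply: sub_sigma_algebra => /=.
rewrite -bigcup_seq/=; exists i => /=; first by rewrite mem_index_enum.
by exists Y => //; rewrite setTI.
Qed.

Lemma measurable_fun_rVP d (T : measurableType d) (f : T -> 'rV[R]_n) :
  (forall i, measurable_fun [set: T] (coord i \o f)) ->
  measurable_fun [set: T] f.
Proof.
move=> mf _ A mA; rewrite setTI.
have : preimage_set_system [set: T] f (g_sigma_preimage coord) (f @^-1` A).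
  by exists A => //; rewrite setTI.
rewrite -g_sigma_preimage_comp; apply: smallest_sub.
  exact: sigma_algebra_measurable.
rewrite -bigcup_seq/= => B [i _ [C mC <-]].
exact: mf.
Qed.

End rV_measurable.

(* Lebesgue measure on R^n: iterated product of the Lebesgue measure of the
   line, transported along R * R^n -> R^(n+1). *)
Section lebesgue_rV.
Context (R : realType).

Definition rV_cons n (p : measurableTypeR R * 'rV[R]_n) : 'rV[R]_n.+1 :=
  row_mx (p.1)%:M p.2.

Definition rV_uncons n (x : 'rV[R]_n.+1) : measurableTypeR R * 'rV[R]_n :=
  (x 0 0, \row_j x 0 (lift 0 j)).

Lemma rV_cons0 n t (x : 'rV[R]_n) : rV_cons (t, x) 0 0 = t.
Proof.
have -> : (0 : 'I_n.+1) = lshift n (0 : 'I_1) by exact/val_inj.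
by apply: etrans (row_mxEl _ _ _ _) _; rewrite mxE mulr1n.
Qed.

Lemma rV_cons_lift n t (x : 'rV[R]_n) j : rV_cons (t, x) 0 (lift 0 j) = x 0 j.
Proof.
have -> : lift (0 : 'I_n.+1) j = rshift 1 j by exact/val_inj.
exact: row_mxEr.
Qed.

Lemma rV_consK n : cancel (@rV_cons n) (@rV_uncons n).
Proof.
move=> [t x]; rewrite /rV_uncons rV_cons0; congr pair.
by apply/rowP => j; rewrite mxE rV_cons_lift.
Qed.

Lemma measurable_rV_cons n : measurable_fun [set: _] (@rV_cons n).
Proof.
apply: measurable_fun_rVP => i.
have [j ->|j ->] := split_ordP (i : 'I_(1 + n)).
  rewrite (_ : _ \o _ = fst)//; apply/funext => p /=.
  by apply: etrans (row_mxEl _ _ _ _) _; rewrite mxE ord1 mulr1n.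
rewrite (_ : _ \o _ = (fun x : 'rV[R]_n => x 0 j : measurableTypeR R) \o snd).
  by apply: measurableT_comp => //; exact: measurable_coord.
by apply/funext => p /=; exact: row_mxEr.
Qed.

Lemma measurable_rV_uncons n : measurable_fun [set: _] (@rV_uncons n).
Proof.
apply: measurable_fun_pair; first exact: measurable_coord.
apply: measurable_fun_rVP => i.
rewrite (_ : _ \o _ = fun x : 'rV[R]_n.+1 => x 0 (lift 0 i) : measurableTypeR R).
  exact: measurable_coord.
by apply/funext => p /=; rewrite mxE.
Qed.

Section step.
Context (n : nat) (mu : {sigma_finite_measure set 'rV[R]_n -> \bar R}).

Definition lebesgue_rV_step : set 'rV[R]_n.+1 -> \bar R :=
  pushforward (@lebesgue_measure R \x mu)%E (@rV_cons n).

Let step0 : lebesgue_rV_step set0 = 0%E.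
Proof. by rewrite /lebesgue_rV_step /pushforward preimage_set0 measure0. Qed.

Let step_ge0 A : (0 <= lebesgue_rV_step A)%E.
Proof. exact: (measure_ge0 (@lebesgue_measure R \x mu)%E). Qed.

Let step_sigma_additive : semi_sigma_additive lebesgue_rV_step.
Proof.
exact: (@measure_semi_sigma_additive _ _ _
  (measure_function_pushforward__canonical__measure_function_Measure
     (@lebesgue_measure R \x mu)%E (@measurable_rV_cons n))).
Qed.

HB.instance Definition _ := isMeasure.Build _ _ _ lebesgue_rV_step
  step0 step_ge0 step_sigma_additive.

Let step_sigma_finite : sigma_finite setT lebesgue_rV_step.
Proof.
have /sigma_finiteP[F [TF ndF Foo]] := sigma_finiteT (@lebesgue_measure R).
have /sigma_finiteP[G [TG ndG Goo]] := sigma_finiteT mu.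
exists (fun k => @rV_uncons n @^-1` (F k `*` G k)).
  apply/esym; rewrite -subTset => x _.
  have [i _ Fi] : (\bigcup_i F i) (rV_uncons x).1 by rewrite -TF.
  have [j _ Gj] : (\bigcup_j G j) (rV_uncons x).2 by rewrite -TG.
  exists (maxn i j) => //; split.
  - by move: Fi; exact/subsetPset/ndF/leq_maxl.
  - by move: Gj; exact/subsetPset/ndG/leq_maxr.
move=> k; have [mF Fk] := Foo k; have [mG Gk] := Goo k; split.
  rewrite -[X in measurable X]setTI; apply: measurable_rV_uncons => //.
  exact: measurableX.
rewrite /lebesgue_rV_step /pushforward -comp_preimage.
have -> : @rV_uncons n \o @rV_cons n = id.
  by apply/funext => p; exact: rV_consK.
by rewrite preimage_id product_measure1E// lte_mul_pinfty// ge0_fin_numE.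
Qed.

HB.instance Definition _ := Measure_isSigmaFinite.Build _ _ _ lebesgue_rV_step
  step_sigma_finite.

End step.

Fixpoint lebesgue_rV (n : nat) : {sigma_finite_measure set 'rV[R]_n -> \bar R} :=
  match n with
  | 0 => \d_(0 : 'rV[R]_0)
  | n'.+1 => lebesgue_rV_step (lebesgue_rV n')
  end.

Lemma lebesgue_rV_box n (a b : 'rV[R]_n) : (forall i, a 0 i <= b 0 i) ->
  lebesgue_rV n [set x : 'rV[R]_n | forall i, a 0 i <= x 0 i <= b 0 i] =
  (\prod_i (b 0 i - a 0 i))%:E.
Proof.
elim: n a b => [|n IHn] a b ab.
  by rewrite big_ord0 /= diracE mem_set//= => -[].
pose a' : 'rV[R]_n := \row_j a 0 (lift 0 j).
pose b' : 'rV[R]_n := \row_j b 0 (lift 0 j).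
have mbox : measurable [set x : 'rV[R]_n | forall i, a' 0 i <= x 0 i <= b' 0 i].
  rewrite (_ : [set _ | _] =
      \bigcap_(i in [set: 'I_n]) ((fun x : 'rV[R]_n => x 0 i) @^-1`
        `[a' 0 i, b' 0 i])); last first.
    apply/seteqP; split => x /= h i; first by rewrite /= in_itv/= h.
    by have /= := h i I; rewrite in_itv.
  apply: fin_bigcap_measurable => // i _.
  by rewrite -[X in measurable X]setTI; exact: (@measurable_coord R n i).
transitivity ((@lebesgue_measure R \x lebesgue_rV n)%E (`[a 0 0, b 0 0] `*`
    [set x : 'rV[R]_n | forall i, a' 0 i <= x 0 i <= b' 0 i])).
  congr product_measure1; apply/seteqP; split => -[t x] /=.
    rewrite in_itv/= => h; split=> [|i]; first by have := h 0; rewrite rV_cons0.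
    by rewrite !mxE; have := h (lift 0 i); rewrite (rV_cons_lift t x i).
  rewrite in_itv/= => -[h0 h] i; case: (unliftP 0 i) => [j ->|->].
    by rewrite (rV_cons_lift t x j); have := h j; rewrite !mxE.
  by rewrite rV_cons0.
rewrite product_measure1E// IHn => [|i]; last by rewrite !mxE.
rewrite big_ord_recl EFinM; congr (_ * _)%E; last first.
  by congr EFin; apply: eq_bigr => i _; rewrite !mxE.
apply: etrans (lebesgue_measure_itv _) _; rewrite /= lte_fin.
by case: ltgtP (ab 0) => // -> _; rewrite subrr.
Qed.

End lebesgue_rV.

(* Differential forms.  The exterior algebra of R^n has the basis
   dx^S = dx^{a_1} /\ ... /\ dx^{a_k} for S = {a_1 < ... < a_k}, so a covector
   is the family of its coefficients on all S, and a k-covector is one that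
   vanishes off the S of cardinal k.  The basis (dx^S)_S is orthonormal. *)
Section forms.
Context (R : realType) (n : nat).

Definition covector := {ffun {set 'I_n} -> R}.
Definition dform := 'rV[R]_n -> covector.

Definition kcovector (k : nat) : set covector :=
  [set a | forall S : {set 'I_n}, #|S| != k -> a S = 0].

Definition kform (k : nat) : set dform := [set w | forall x, kcovector k (w x)].

Definition cdot (a b : covector) : R := \sum_S a S * b S.

(* dx^i /\ dx^S = sgn i S * dx^(i |: S) when i \notin S. *)
Definition sgn (i : 'I_n) (S : {set 'I_n}) : R :=
  (-1) ^+ #|[set j in S | (j < i)%N]%SET|.

(* dx^S /\ dx^(~: S) = hodge_sgn S * dx^1 /\ ... /\ dx^n. *)
Definition hodge_sgn (S : {set 'I_n}) : R :=
  (-1) ^+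
  #|[set p : 'I_n * 'I_n | [&& p.1 \in S, p.2 \notin S & (p.2 < p.1)%N]]%SET|.

(* star dx^S = hodge_sgn S * dx^(~: S) *)
Definition hodge (a : covector) : covector :=
  [ffun S : {set 'I_n} => hodge_sgn (~: S) * a (~: S)].

(* Contraction with the position vector x; on dx^S the term i has the sign
   (-1)^(number of elements of S smaller than i). *)
Definition koszul (x : 'rV[R]_n) (a : covector) : covector :=
  [ffun S : {set 'I_n} => \sum_(i | i \notin S) sgn i S * x 0 i * a (i |: S)].

Definition partial (i : 'I_n) (f : 'rV[R]_n -> R) (x : 'rV[R]_n) : R :=
  'D_(delta_mx 0 i) f x.

(* d w = \sum_i dx^i /\ partial_i w *)
Definition ext_d (w : dform) : dform := fun x =>
  [ffun S : {set 'I_n} =>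
    \sum_(i in S) sgn i S * partial i (fun y => w y (S :\ i)) x].

(* The codifferential; by ext_d_codiff below, cdot (ext_d mu) eta and
   cdot mu (codiff eta) differ by a divergence, so that codiff is the formal
   adjoint of ext_d. *)
Definition codiff (w : dform) : dform := fun x =>
  [ffun S : {set 'I_n} =>
    - \sum_(i | i \notin S) sgn i S * partial i (fun y => w y (i |: S)) x].

Lemma ext_d_codiff (mu eta : dform) (x : 'rV[R]_n) :
  (forall S, differentiable (fun y => mu y S) x) ->
  (forall S, differentiable (fun y => eta y S) x) ->
  cdot (ext_d mu x) (eta x) - cdot (mu x) (codiff eta x) =
  \sum_i partial i (fun y =>
    \sum_(S : {set 'I_n} | i \in S) sgn i S * (mu y (S :\ i) * eta y S)) x.
Proof.
move=> dmu deta.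
have dsum i (P : pred {set 'I_n}) (f : {set 'I_n} -> 'rV[R]_n -> R) df :
    (forall S, is_derive x (delta_mx 0 i) (f S) (df S)) ->
    partial i (fun y => \sum_(S | P S) f S y) x = \sum_(S | P S) df S.
  move=> fdf; rewrite /partial.
  have -> : (fun y => \sum_(S | P S) f S y) = \sum_(S | P S) f S.
    by apply/funext => y; rewrite fct_sumE.
  suff : is_derive x (delta_mx 0 i) (\sum_(S | P S) f S) (\sum_(S | P S) df S).
    by move=> h; rewrite derive_val.
  by elim/big_ind2 : _ => [|f1 df1 f2 df2 h1 h2|S _];
    [exact: is_derive_cst|exact: is_deriveD|exact: fdf].
pose D i (f : dform) S : R := partial i (fun y => f y S) x.
have -> : \sum_i partial i (fun y => \sum_(S : {set 'I_n} | i \in S)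
      sgn i S * (mu y (S :\ i) * eta y S)) x =
    \sum_i \sum_(S : {set 'I_n} | i \in S) sgn i S *
      (mu x (S :\ i) * D i eta S + eta x S * D i mu (S :\ i)).
  apply: eq_bigr => i _; apply: dsum => S.
  have h1 : is_derive x (delta_mx 0 i) (fun y => mu y (S :\ i)) (D i mu (S :\ i)).
    exact/derivableP/diff_derivable.
  have h2 : is_derive x (delta_mx 0 i) (fun y => eta y S) (D i eta S).
    exact/derivableP/diff_derivable.
  have := is_deriveZ (sgn i S) (is_deriveM h1 h2).
  by move=> h; exact: h.
have -> : cdot (ext_d mu x) (eta x) =
    \sum_i \sum_(S : {set 'I_n} | i \in S) sgn i S * (eta x S * D i mu (S :\ i)).
  rewrite /cdot (exchange_big_dep xpredT)//=; apply: eq_bigr => S _.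
  rewrite ffunE mulr_suml; apply: eq_bigr => i _.
  by rewrite -mulrA [_ * eta x S]mulrC.
have -> : cdot (mu x) (codiff eta x) =
    - \sum_i \sum_(S : {set 'I_n} | i \in S) sgn i S * (mu x (S :\ i) * D i eta S).
  rewrite -sumrN.
  transitivity (\sum_i \sum_(S : {set 'I_n} | i \notin S)
      - (sgn i S * (mu x S * D i eta (i |: S)))).
    rewrite (exchange_big_dep xpredT)//=; apply: eq_bigr => S _.
    rewrite ffunE mulrN mulr_sumr -sumrN; apply: eq_bigr => i _.
    by rewrite mulrCA.
  apply: eq_bigr => i _; rewrite -sumrN.
  rewrite (reindex_onto (fun S => S :\ i) (fun S => i |: S)) /=; last first.
    by move=> S iS; rewrite finset.setU1K.
  apply: eq_big => S.
    rewrite finset.setD11 /=; apply/eqP/idP => [<-|iS]; last exact: finset.setD1K.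
    by rewrite finset.setU11.
  move=> /andP[_ /eqP Si]; rewrite Si; congr (- (_ * _)).
  rewrite /sgn; congr (_ ^+ _); apply: eq_card => j; rewrite !inE.
  by case: ltngtP; rewrite ?andbF ?andbT// => ji; rewrite -val_eqE/= ltn_eqF.
rewrite opprK -big_split /=; apply: eq_bigr => i _.
by rewrite -big_split /=; apply: eq_bigr => S _; rewrite mulrDr addrC.
Qed.

Definition smooth (f : 'rV[R]_n -> R) : Prop :=
  forall (s : seq 'I_n) (x : 'rV[R]_n), differentiable (foldr partial f s) x.

(* Smooth k-forms on R^n with compact support contained in D. *)
Definition test_form (D : set 'rV[R]_n) (k : nat) : set dform :=
  [set eta | [/\ kform k eta, forall S, smooth (fun x => eta x S) &
    exists K : set 'rV[R]_n,
      [/\ compact K, K `<=` D & forall x, ~ K x -> eta x = 0]]].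

Definition L2form (D : set 'rV[R]_n) (k : nat) : set dform :=
  [set w | kform k w /\ forall S, measurable_fun D (fun x => w x S) /\
    (lebesgue_rV R n).-integrable D (fun x => ((w x S) ^+ 2)%:E)].

Definition L2dot (D : set 'rV[R]_n) (w eta : dform) : R :=
  \int[lebesgue_rV R n]_(x in D) cdot (w x) (eta x).

Definition L2norm (D : set 'rV[R]_n) (w : dform) : R := Num.sqrt (L2dot D w w).

(* tau is the exterior derivative, in the sense of distributions on D, of the
   k-form w, and is square integrable.  For k = n this forces tau = 0. *)
Definition weak_d (D : set 'rV[R]_n) (k : nat) (w : dform) : set dform :=
  [set tau | L2form D k.+1 tau /\ forall eta, test_form D k.+1 eta ->
    L2dot D tau eta = L2dot D w (codiff eta)].

Definition Hform (D : set 'rV[R]_n) (k : nat) : set dform :=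
  [set w | L2form D k w /\ exists tau, weak_d D k w tau].

(* Representative of the weak derivative, which is unique up to a null set. *)
Definition d_on (D : set 'rV[R]_n) (k : nat) (w : dform) : dform :=
  xget (fun=> 0) (weak_d D k w).

Definition P0 (k : nat) : set dform :=
  [set w | exists2 a, kcovector k a & w = fun=> a].

Definition P1m (k : nat) : set dform :=
  [set w | exists a b, [/\ kcovector k a, kcovector k.+1 b &
    w = fun x => a + koszul x b]].

Definition P1sm (k : nat) : set dform :=
  [set (fun x => hodge (w x)) | w in P1m (n - k)].

(* The equations defining the local interpolator on D. *)
Definition is_interp (D : set 'rV[R]_n) (k : nat) (w mu : dform) : Prop :=
  P1m k mu /\ forall eta, P1sm k.+1 eta ->
    L2dot D mu (codiff eta) - L2dot D (d_on D k mu) eta =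
    L2dot D w (codiff eta) - L2dot D (d_on D k w) eta.

Definition is_L2proj_P0 (D : set 'rV[R]_n) (k : nat) (w mu : dform) : Prop :=
  P0 k mu /\ forall eta, P0 k eta -> L2dot D mu eta = L2dot D w eta.

(* On the interior of a simplex the equations have exactly one solution. *)
Definition interp (D : set 'rV[R]_n) (k : nat) (w : dform) : dform :=
  xget (fun=> 0)
    (if (k < n)%N then is_interp D k w else is_L2proj_P0 D k w).

End forms.

(* Simplices (of any dimension) are given by the matrix whose rows are their vertices. *)
Section meshes.
Context (R : realType) (n : nat).

Definition enorm (x : 'rV[R]_n) : R := Num.sqrt (\sum_i x 0 i ^+ 2).

(* Convex hull of the rows of V with index in A. *)
Definition face m (V : 'M[R]_(m, n)) (A : {set 'I_m}) : set 'rV[R]_n :=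
  [set x | exists l : 'rV[R]_m, [/\ forall i, 0 <= l 0 i,
    forall i, i \notin A -> l 0 i = 0, \sum_i l 0 i = 1 & x = l *m V]].

Definition hull m (V : 'M[R]_(m, n)) : set 'rV[R]_n := face V [set: 'I_m]%SET.

Definition affinely_independent m (V : 'M[R]_(m, n)) : Prop :=
  forall c : 'rV[R]_m, \sum_i c 0 i = 0 -> c *m V = 0 -> c = 0.

(* The boundary is a finite union of (n-1)-simplices. *)
Definition polyhedral_domain (Om : set 'rV[R]_n) : Prop :=
  [/\ Om !=set0, open Om, connected Om, bounded_set Om &
    exists2 B : seq 'M[R]_(n, n),
      (forall V, V \in B -> affinely_independent V) &
      closure Om `\` Om = \bigcup_(V in [set` B]) hull V].

Definition cell (T : 'M[R]_(n.+1, n)) : set 'rV[R]_n := interior (hull T).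

Definition diam (A : set 'rV[R]_n) : R :=
  sup [set enorm (p.1 - p.2) | p in A `*` A].

Definition inradius (A : set 'rV[R]_n) : R :=
  sup [set r | 0 <= r /\ exists c, [set x | enorm (x - c) <= r] `<=` A].

(* Conformity: distinct cells meet along a common proper face, which is empty
   when the sets of vertices A and B are. *)
Definition simplicial_subdivision (Om : set 'rV[R]_n)
    (G : {fset 'M[R]_(n.+1, n)}) : Prop :=
  [/\ forall T, T \in G -> affinely_independent T,
      closure Om = \bigcup_(T in [set` G]) hull T,
      forall T, T \in G -> cell T `<=` Om &
      forall T T', T \in G -> T' \in G -> T != T' ->
        exists A B : {set 'I_n.+1}, [/\ A \proper [set: 'I_n.+1]%SET,
          B \proper [set: 'I_n.+1]%SET,
          hull T `&` hull T' = face T A & hull T `&` hull T' = face T' B]].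

Definition shape_regular (F : set {fset 'M[R]_(n.+1, n)}) : Prop :=
  exists sigma : R, forall G T, F G -> T \in G ->
    diam (hull T) / inradius (hull T) <= sigma.

(* The form equal to f T on the cell T of G, for every T. *)
Definition cellwise (G : {fset 'M[R]_(n.+1, n)})
    (f : 'M[R]_(n.+1, n) -> dform R n) : dform R n :=
  fun x => \sum_(T <- G | x \in cell T) f T x.

Definition d_h (G : {fset 'M[R]_(n.+1, n)}) (k : nat) (w : dform R n) :=
  cellwise G (fun T => d_on (cell T) k w).

Definition interp_h (G : {fset 'M[R]_(n.+1, n)}) (k : nat) (w : dform R n) :=
  cellwise G (fun T => interp (cell T) k w).

(* Global square integrability only constrains the values of eta on the
   skeleton of G, which is a null set. *)
Definition P1m_h (Om : set 'rV[R]_n) (G : {fset 'M[R]_(n.+1, n)}) (k : nat) :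
    set (dform R n) :=
  [set eta | L2form Om k eta /\ forall T, T \in G ->
    exists2 p, P1m k p & {in cell T, eta =1 p}].

Definition dh_norm (Om : set 'rV[R]_n) (G : {fset 'M[R]_(n.+1, n)}) (k : nat)
    (w : dform R n) : R :=
  Num.sqrt (L2norm Om (d_h G k w) ^+ 2 + L2norm Om w ^+ 2).

End meshes.

(* Main.v *)
(* On one cell T, let x0 be the centroid of T.  An element of P1m k is
   a + kappa_(x - x0) b, with d = (k + 1) b, and an element of P1sm (k + 1) is
   c + (x - x0)^flat /\ e, with codifferential - (n - k) e.  As x - x0 has mean
   zero on T, the equations of the interpolator are diagonal in (a, b): with
   t = d w they give b = avg t / (k + 1) and
   a = avg w + avg (kappa_(x - x0) t) / (n - k).
   Jensen's inequality bounds these averages by the norms of w and t on T, with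
   a constant that depends only on n and on a box containing Om.  Since the
   interpolator is linear and reproduces P1m, the same bound for w - p gives
   quasi-optimality on T, and the squares of the norms add up over the cells,
   the skeleton being a null set.

   Weak derivatives are chosen representatives, so one also needs that they are
   unique almost everywhere (fundamental lemma of the calculus of variations) and
   that polynomial forms have their classical derivative (integration by parts,
   by Fubini and the fundamental theorem of calculus). *)
Require Import Defs.
From mathcomp Require Import all_boot all_order all_algebra finmap.
From mathcomp Require Import all_classical all_reals all_analysis.
From mathcomp Require Import measurable_realfun ring lra.
Import Order.TTheory GRing.Theory Num.Theory.
Import numFieldNormedType.Exports.
Local Open Scope classical_set_scope.
Local Open Scope ring_scope.
Set Implicit Arguments.
Unset Strict Implicit.
Unset Printing Implicit Defensive.

(** * Boxes and the Borel sigma-algebra of R^n *)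

(** The equations decouple for two reasons. Exterior multiplication by (x - x0)^flat is the adjoint
    of the Koszul contraction by x - x0, so the linear part of a test form can be moved onto t; each
    cross term is then a mean of coordinates of x - x0. Up to a common factor, a + kappa_(x - x0) b
    tested against c + (x - x0)^flat /\ e gives (n - k) a.e + (k + 1) b.c, and uniqueness follows by
    testing with the defect itself. Stability holds because means are contractions of L2 and the
    only linear factor, x - x0, is bounded coordinatewise by 2|M| inside a box of half-width M. The
    obstacle is that [d_on] is an arbitrary representative of a weak derivative: nothing can be
    computed from it before it has been identified almost everywhere with a known form. The
    identification requires test forms that are smooth in the literal sense of [smooth], through all
    iterated partial derivatives. They are products of functions p(1/t) e^(-1/t), a family stable
    under differentiation. *)

Section boxes.
Context (R : realType) (n : nat).
Implicit Types (a b x : 'rV[R]_n) (U : set 'rV[R]_n).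

Definition obox a b : set 'rV[R]_n := [set x | forall i, a 0 i < x 0 i < b 0 i].
Definition cbox a b : set 'rV[R]_n := [set x | forall i, a 0 i <= x 0 i <= b 0 i].

(** Makes the open boxes a pi-system, for the Dynkin argument below. *)
Lemma oboxI a b a' b' : obox a b `&` obox a' b' =
  obox (\row_i Num.max (a 0 i) (a' 0 i)) (\row_i Num.min (b 0 i) (b' 0 i)).
Proof.
apply/seteqP; split => x /=.
  move=> [h h'] i; rewrite !mxE gt_max lt_min.
  by have /andP[-> ->] := h i; have /andP[-> ->] := h' i.
move=> h; split => i; have := h i; rewrite !mxE gt_max lt_min.
  by move=> /andP[/andP[-> _] /andP[-> _]].
by move=> /andP[/andP[_ ->] /andP[_ ->]].
Qed.

(** Cubes with rational centre and half-width form a countable base. The closed version [crbox] is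
    compact, so a cutoff on [rbox p] is an admissible test function wherever [crbox p] is contained
    in the domain. *)
Definition rbox (p : 'rV[rat]_n * rat) :=
  obox (\row_i (ratr (p.1 0 i) - ratr p.2)) (\row_i (ratr (p.1 0 i) + ratr p.2)).
Definition crbox (p : 'rV[rat]_n * rat) :=
  cbox (\row_i (ratr (p.1 0 i) - ratr p.2)) (\row_i (ratr (p.1 0 i) + ratr p.2)).

Lemma open_bigcup_rbox U : open U ->
  U = \bigcup_(p in [set p | crbox p `<=` U]) rbox p.
Proof.
move=> oU; apply/seteqP; split => [x Ux|x [p pU] px]; last first.
  by apply: pU => i; have := px i; rewrite !mxE => /andP[/ltW -> /ltW ->].
have /nbhs_ballP[e /= e0 xeU] : nbhs x U by apply: open_nbhs_nbhs.
(* Both x and any y of the closed cube are within r of its centre, so 2 r < e keeps the cube in the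
   ball. *)
have /rat_in_itvoo[r] : 0 < e / 2 by rewrite divr_gt0.
rewrite in_itv/= => /andP[r0 re].
have /choice[q qP] : forall i : 'I_n, exists q : rat, `|x 0 i - ratr q| < ratr r.
  move=> i; have /rat_in_itvoo[q] : x 0 i - ratr r < x 0 i + ratr r.
    by rewrite ltrBlDr -addrA ltrDl addr_gt0.
  rewrite in_itv/= => /andP[h1 h2]; exists q.
  by rewrite ltr_norml; lra.
exists (\row_i q i, r) => /=.
  move=> y yB; apply: xeU; split => // i j; rewrite (ord1 i).
  have := yB j; rewrite !mxE /ball/= => /andP[h1 h2].
  have -> : x 0 j - y 0 j = (x 0 j - ratr (q j)) + (ratr (q j) - y 0 j).
    by rewrite addrA subrK.
  apply: (le_lt_trans (ler_normD _ _)).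
  have : `|ratr (q j) - y 0 j| <= ratr r.
    by rewrite ler_norml; lra.
  by have := qP j; lra.
move=> i; rewrite !mxE/=; have := qP i; rewrite ltr_norml => /andP[h1 h2].
by lra.
Qed.

Lemma obox_open a b : open (obox a b).
Proof.
rewrite openE => x xB.
suff : \forall y \near x, forall i : 'I_n, a 0 i < (y : 'rV[R]_n) 0 i < b 0 i by [].
apply: (@filter_forall 'rV[R]_n 'I_n (fun i => [set y : 'rV[R]_n | a 0 i < y 0 i < b 0 i]) (nbhs x)) => i.
have : nbhs (x 0 i) `]a 0 i, b 0 i[%classic.
  by apply: open_nbhs_nbhs; split; [exact: (@interval_open R)|rewrite /= in_itv/=; exact: xB].
move=> /(@coord_continuous R 1 n 0 i x).
by apply: (@filterS _ (nbhs x)) => y /=; rewrite in_itv.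
Qed.

Lemma compact_cbox a b : compact (cbox a b).
Proof.
have -> : cbox a b = [set v | forall i, `[a 0 i, b 0 i]%classic (v ord0 i)].
  by apply/seteqP; split => x /= h i; have := h i; rewrite in_itv.
exact: (@rV_compact R n (fun i => `[a 0 i, b 0 i]%classic) (fun i => @segment_compact R (a 0 i) (b 0 i))).
Qed.

(** Open sets are countable unions of rational cubes, which brings the coordinate slabs into the
    sigma-algebra of the boxes; conversely a box is a finite intersection of slabs. *)
Lemma rV_measurableE : @measurable _ 'rV[R]_n = <<s [set obox p.1 p.2 | p in setT] >>.
Proof.
set S := (X in _ = X).
have Sopen U : open U -> S U.
  move=> oU; rewrite (open_bigcup_rbox oU) bigcup_mkcond.
  pose T := (g_sigma_algebraType [set obox p.1 p.2 | p in [set: 'rV[R]_n * 'rV[R]_n]]).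
  have := @countable_bigcupT_measurable _ T ('rV[rat]_n * rat)%type.
  apply => // p; case: ifPn => _; last exact: (@measurable0 _ T).
  by apply: sub_sigma_algebra; eexists (_, _).
apply/seteqP; split.
  apply: smallest_sub; first exact: smallest_sigma_algebra.
  rewrite -bigcup_seq => A [i _ [Y mY <-]]; rewrite setTI.
  move: Y mY; rewrite measurable_realfun.RGenOpens.measurableE.
  (* The sets with preimage in S form a sigma-algebra, so open intervals suffice. *)
  have : sigma_algebra setT (fun Y => S ((fun x : 'rV[R]_n => x 0 i) @^-1` Y)).
    split.
    - by rewrite preimage_set0; exact: sigma_algebra0.
    - by move=> Y SY; rewrite setTD preimage_setC -setTD; exact: sigma_algebraCD.
    - by move=> F SF; rewrite preimage_bigcup; exact: sigma_algebra_bigcup.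
  move=> sS; apply: smallest_sub => // _ [c [d ->]].
  apply: Sopen; apply: open_comp => [x _|]; last exact: (@interval_open R).
  exact: coord_continuous.
apply: smallest_sub; first exact: sigma_algebra_measurable.
move=> _ [[a b] _ <-].
rewrite (_ : obox _ _ =
    \bigcap_(i in [set: 'I_n]) ((fun x : 'rV[R]_n => x 0 i) @^-1`
        `]a 0 i, b 0 i[)); last first.
  apply/seteqP; split => x /= h i; first by rewrite /= in_itv/= h.
  by have /= := h i I; rewrite in_itv.
apply: fin_bigcap_measurable => // i _.
by rewrite -[X in measurable X]setTI; exact: (@measurable_coord R n i).
Qed.

Lemma rV_open_measurable U : open U -> measurable U.
Proof.
move=> oU; rewrite (open_bigcup_rbox oU) bigcup_mkcond.
apply: countable_bigcupT_measurable => // p; case: ifPn => // _.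
by rewrite rV_measurableE; apply: sub_sigma_algebra; eexists (_, _).
Qed.

Lemma rV_continuous_measurable (f : 'rV[R]_n -> R) :
  continuous f -> measurable_fun setT f.
Proof.
move=> cf; apply: (measurability _ (measurable_realfun.RGenOpens.measurableE R)).
move=> _ [_ [a [b ->] <-]]; rewrite setTI; apply: rV_open_measurable.
by apply: open_comp => [x _|]; [exact: cf|exact: (@interval_open R)].
Qed.

End boxes.

(** * Affine hyperplanes are null sets *)

Section hyperplane.
Context (R : realType).

Lemma affine_continuous n (c : 'rV[R]_n) (d : R) :
  continuous (fun x : 'rV[R]_n => \sum_i c 0 i * x 0 i + d).
Proof.
move=> x; apply: (@continuousD _ _ _ (fun y : 'rV[R]_n => \sum_i c 0 i * y 0 i) (cst d)); last exact: cst_continuous.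

have -> : (fun y : 'rV[R]_n => \sum_i c 0 i * y 0 i) =
    \sum_i (fun y : 'rV[R]_n => c 0 i * y 0 i).
  by apply/funext => y; rewrite fct_sumE.
elim/big_ind : _ => [|f g cf cg|i _].
- exact: (@cst_continuous _ _ 0).
- exact: (@continuousD _ _ _ f g).
- apply: (@continuousM _ _ (cst (c 0 i)) (fun y : 'rV[R]_n => y 0 i)).
    exact: cst_continuous.
  exact: coord_continuous.
Qed.

Lemma measurable_hyperplane n (c : 'rV[R]_n) (d : R) :
  measurable [set x : 'rV[R]_n | \sum_i c 0 i * x 0 i + d = 0].
Proof.
have -> : [set x : 'rV[R]_n | \sum_i c 0 i * x 0 i + d = 0] =
    (fun x : 'rV[R]_n => \sum_i c 0 i * x 0 i + d) @^-1` [set 0] by [].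
rewrite -[X in measurable X]setTI.
by apply: (rV_continuous_measurable (affine_continuous (c := c) (d := d))).
Qed.

(** Induction on the dimension, slicing along the first coordinate. The hypothesis allows c = 0 with
    d nonzero (the empty set), which is what a nonzero column of an inverse matrix provides in
    [bary_null]. *)
Lemma hyperplane_null n (c : 'rV[R]_n) (d : R) : (c != 0) || (d != 0) ->
  lebesgue_rV R n [set x : 'rV[R]_n | \sum_i c 0 i * x 0 i + d = 0] = 0%E.
Proof.
elim: n c d => [|n IHn] c d cd.
  rewrite (_ : [set x | _] = set0) ?measure0//; apply/seteqP; split => x //=.
  move: cd; rewrite big_ord0 add0r (_ : c = 0) ?eqxx/=; last by apply/rowP => -[].
  by move=> /eqP.
pose c' : 'rV[R]_n := \row_j c 0 (lift 0 j).
pose A := [set x : 'rV[R]_n.+1 | \sum_i c 0 i * x 0 i + d = 0].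
have AE t (y : 'rV[R]_n) : A (rV_cons (t, y)) <->
    \sum_i c' 0 i * y 0 i + (c 0 0 * t + d) = 0.
  rewrite /A/= big_ord_recl rV_cons0 addrAC -addrA (addrC (\sum_i _)).
  rewrite (eq_bigr (fun i => c' 0 i * y 0 i)) => [|i _]; last by rewrite rV_cons_lift mxE.
  by rewrite addrA addrC addrA.
rewrite -[LHS]/((@lebesgue_measure R \x lebesgue_rV R n)%E (@rV_cons R n @^-1` A)).
(* If c' is nonzero, every slice is a null hyperplane of R^n. Otherwise the set is empty or the
   product of one point with R^n. *)
have [c'0|c'0] := eqVneq c' 0; last first.
  apply: integral0_eq => t _ /=.
  rewrite -[RHS](IHn c' (c 0 0 * t + d)) ?c'0//; congr (lebesgue_rV R n _).
  by apply/seteqP; split => y; rewrite /xsection/= inE => /AE.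
have [c0|c0] := eqVneq (c 0 0) 0.
  rewrite (_ : _ @^-1` _ = set0) ?measure0//; apply/seteqP; split => -[t y] //= /AE.
  rewrite c'0 c0 mul0r add0r big1 ?add0r => [dE|i _]; last by rewrite mxE mul0r.
  move: cd; rewrite dE eqxx orbF => /eqP; apply; apply/rowP => i; rewrite mxE.
  by case: (unliftP 0 i) => [j ->|-> //]; move/rowP: c'0 => /(_ j); rewrite !mxE.
have mA : measurable (@rV_cons R n @^-1` A).
  rewrite -[X in measurable X]setTI; apply: measurable_rV_cons => //.
  exact: measurable_hyperplane.
pose m : {measure set _ -> \bar R} := (@lebesgue_measure R \x lebesgue_rV R n)%E.
pose B : set (measurableTypeR R * 'rV[R]_n) := [set - d / c 0 0] `*` setT.
have mB : measurable B by exact: measurableX.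
apply: (@subset_measure0 _ _ _ m _ B mA mB).
  move=> -[t y] /AE; rewrite c'0 big1 => [|i _]; last by rewrite mxE mul0r.
  rewrite add0r => /eqP h; split => //=; apply/eqP.
  by rewrite -(inj_eq (mulfI c0)) (mulrC _ (- d / _)) divfK// -subr_eq0 opprK.
rewrite /m/= product_measure1E//.
rewrite [X in (X * _)%E](_ : _ = 0%E) ?mul0e//; exact: lebesgue_measure_set1.
Qed.

End hyperplane.

(** * Integrals of partial derivatives *)

Section cont_row.
Context (R : realType).

Lemma cvg_rV (T : Type) (F : set_system T) (FF : Filter F) n (f : T -> 'rV[R]_n)
    (l : 'rV[R]_n) :
  (forall i, (fun x => f x 0 i) @ F --> l 0 i) -> f @ F --> l.
Proof.
move=> h A [P /= Pl PA]; apply: (filterS (P := [set x | forall i, P 0 i (f x 0 i)])).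
  by move=> x /= Px; apply: PA => i j; rewrite (ord1 i).
apply: (@filter_forall _ _ (fun i => [set x | P 0 i (f x 0 i)]) F) => i.
exact: (h i _ (Pl 0 i)).
Qed.

Lemma continuous_rV (T : topologicalType) n (f : T -> 'rV[R]_n) :
  (forall i, continuous (fun x => f x 0 i)) -> continuous f.
Proof. by move=> h x; apply: cvg_rV => i; exact: h. Qed.

Lemma rV_cons_continuous1 n (y : 'rV[R]_n) :
  continuous (fun t : R => rV_cons (t, y)).
Proof.
apply: continuous_rV => i; case: (unliftP 0 i) => [j ->|->].
  under eq_fun do rewrite rV_cons_lift; exact: cst_continuous.
under eq_fun do rewrite rV_cons0; by move=> ?; exact: cvg_id.
Qed.

Lemma rV_cons_continuous2 n (t : R) :
  continuous (fun y : 'rV[R]_n => rV_cons (t, y)).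
Proof.
apply: continuous_rV => i; case: (unliftP 0 i) => [j ->|->].
  under eq_fun do rewrite rV_cons_lift; exact: coord_continuous.
under eq_fun do rewrite rV_cons0; exact: cst_continuous.
Qed.

(** The two difference quotients are the same function of h, so the chain rule along an affine map
    asks only for directional derivatives. *)
Lemma derivable_slice (U V W : normedModType R) (f : V -> W) (phi : U -> V) x v w :
  (forall h : R, phi (h *: v + x) = h *: w + phi x) ->
  (derivable (f \o phi) x v <-> derivable f (phi x) w) /\
  'D_v (f \o phi) x = 'D_w f (phi x).
Proof.
move=> phiE.
have E : (fun h : R => h^-1 *: (((f \o phi) \o shift x) (h *: v) - (f \o phi) x)) =
    (fun h : R => h^-1 *: ((f \o shift (phi x)) (h *: w) - f (phi x))).
  by apply/funext => h /=; rewrite phiE.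
by rewrite /derivable /derive E.
Qed.

Lemma rV_cons_slice0 n (t h : R) (y : 'rV[R]_n) :
  rV_cons (h *: 1 + t, y) = h *: delta_mx 0 0 + rV_cons (t, y).
Proof.
apply/rowP => i; rewrite [RHS]mxE; case: (unliftP 0 i) => [j ->|->].
  by rewrite !rV_cons_lift !mxE/= mulr0 add0r.
by rewrite !rV_cons0 !mxE/= [_ *: 1]mulr1 mulr1.
Qed.

Lemma rV_cons_slice n (t h : R) (y : 'rV[R]_n) j :
  rV_cons (t, h *: delta_mx 0 j + y) = h *: delta_mx 0 (lift 0 j) + rV_cons (t, y).
Proof.
apply/rowP => i; rewrite [RHS]mxE; case: (unliftP 0 i) => [k ->|->].
  by rewrite !rV_cons_lift !mxE/= (inj_eq lift_inj).
by rewrite !rV_cons0 !mxE/= mulr0 add0r.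
Qed.

End cont_row.
Section int_partial.
Context (R : realType).
Notation leb n := (lebesgue_rV R n).

Lemma bounded_support_integrable d (T : measurableType d) (mu : {measure set T -> \bar R})
    (f : T -> R) (A : set T) (M : R) :
  measurable A -> (mu A < +oo)%E -> measurable_fun setT f ->
  (forall x, ~ A x -> f x = 0) -> (forall x, A x -> `|f x| <= M) ->
  mu.-integrable setT (EFin \o f).
Proof.
move=> mA Aoo mf f0 fM.
have fE : EFin \o f = (EFin \o f) \_ A.
  apply/funext => x; rewrite /patch; case: ifPn => // /negP xA /=.
  by rewrite f0// => Ax; apply: xA; rewrite inE.
rewrite fE; apply/(integrable_mkcond _ mA).1.
apply: measurable_bounded_integrable => //.
  exact: measurable_funTS.
exists M; split; first exact: num_real.
by move=> N MN x Ax; apply: (le_trans (fM x Ax)); exact: ltW.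
Qed.

(** Stated coordinatewise so that it passes to slices in the induction on n. *)
Definition supp_in n (M : R) (f : 'rV[R]_n -> R) :=
  forall x : 'rV[R]_n, (exists j, M < `|x 0 j|) -> f x = 0.

Lemma continuous_bounded_cbox n (f : 'rV[R]_n -> R) (a b : 'rV[R]_n) : continuous f ->
  exists C, forall x, cbox a b x -> `|f x| <= C.
Proof.
move=> cf; have cB := @compact_cbox R n a b.
have cfB : {within cbox a b, continuous f} by exact: continuous_subspaceT.
have /compact_bounded[M [_ HM]] := continuous_compact cfB cB.
exists (M + 1) => x xB; apply: (HM (M + 1)); first by rewrite ltrDl.
by exists x.
Qed.

Lemma supp_cbox n M (f : 'rV[R]_n -> R) : supp_in M f ->
  forall x, ~ cbox (const_mx (- M)) (const_mx M) x -> f x = 0.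
Proof.
move=> fM x /existsNP[j]; rewrite !mxE => /negP h; apply: fM; exists j.
by rewrite ltNge ler_norml.
Qed.

Lemma measurable_cbox n (a b : 'rV[R]_n) : measurable (cbox a b).
Proof.
rewrite (_ : cbox _ _ =
    \bigcap_(i in [set: 'I_n]) ((fun x : 'rV[R]_n => x 0 i) @^-1`
        `[a 0 i, b 0 i])); last first.
  apply/seteqP; split => x /= h i; first by rewrite /= in_itv/= h.
  by have /= := h i I; rewrite in_itv.
apply: fin_bigcap_measurable => // i _.
by rewrite -[X in measurable X]setTI; exact: (@measurable_coord R n i).
Qed.

Lemma cbox_fin n (M : R) : (leb n (cbox (const_mx (- M)%R) (const_mx M)) < +oo)%E.
Proof.
have [M0|M0] := leP 0 M.
  by rewrite lebesgue_rV_box ?ltry// => i; rewrite !mxE; lra.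
(* For M < 0 the box is empty when the dimension is positive, and the single point of R^0
   otherwise. *)
case: n => [|n]; first by rewrite /=diracE ltry.
rewrite (_ : cbox _ _ = set0) ?measure0//; apply/seteqP; split => x //= /(_ 0).
by rewrite !mxE; lra.
Qed.

Lemma supp_integrable n M (f : 'rV[R]_n -> R) : continuous f -> supp_in M f ->
  (leb n).-integrable setT (EFin \o f).
Proof.
move=> cf fM; have [C fC] := continuous_bounded_cbox (const_mx (- M)) (const_mx M) cf.
apply: (bounded_support_integrable (measurable_cbox _ _) (cbox_fin n M) _ (supp_cbox fM) fC).
exact: rV_continuous_measurable.
Qed.

Lemma supp_integrable_prod n M (f : 'rV[R]_n.+1 -> R) : continuous f -> supp_in M f ->
  (@lebesgue_measure R \x leb n)%E.-integrable setT ((EFin \o f) \o @rV_cons R n).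
Proof.
move=> cf fM; have [C fC] := continuous_bounded_cbox (const_mx (- M)) (const_mx M) cf.
apply: (@bounded_support_integrable _ _ (@lebesgue_measure R \x leb n)%E (f \o @rV_cons R n)
    (@rV_cons R n @^-1` (cbox (const_mx (- M)) (const_mx M))) C).
- rewrite -[X in measurable X]setTI; apply: measurable_rV_cons => //.
  exact: measurable_cbox.
- exact: (cbox_fin n.+1 M).
- apply: measurableT_comp; last exact: measurable_rV_cons.
  exact: rV_continuous_measurable.
- by move=> x h; apply: (supp_cbox fM).
- by move=> x h; exact: fC.
Qed.

(** The strict inequality is an open condition, so g vanishes on a whole neighbourhood of x. *)
Lemma partial_supp n M (g : 'rV[R]_n -> R) i : supp_in M g -> supp_in M (partial i g).
Proof.
move=> gM x [j xj]; rewrite /partial /derive.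
have : \forall y \near x, g y = 0.
  have : \forall y \near x, M < `|(y : 'rV[R]_n) 0 j|.
    have h : (y : 'rV[R]_n) 0 j @[y --> x] --> x 0 j by exact: coord_continuous.
    exact: cvgr_gt (cvg_norm h) _ xj.
  by apply: filterS => y h; apply: gM; exists j.
move=> /(@nbhs0P R) h0.
have gx0 : g x = 0 by apply: gM; exists j.
apply: cvg_lim => //; apply: cvg_near_cst.
have e0 : (fun h : R => h *: (delta_mx 0 i : 'rV[R]_n)) @ 0 --> (0 : 'rV[R]_n).
  rewrite -[X in _ --> X](scale0r (delta_mx 0 i : 'rV[R]_n)).
  by apply: cvgZr_tmp => //; exact: cvg_id.
have := e0 _ h0; move=> /= h1; apply: nbhs_dnbhs; move: h1.
apply: (@filterS _ (nbhs (0 : R))) => h /= gh.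
by rewrite (addrC _ x) gh gx0 subr0 scaler0.
Qed.

Lemma partial_cons n (g : 'rV[R]_n.+1 -> R) t (y : 'rV[R]_n) j :
  (derivable (g \o (fun y => rV_cons (t, y))) y (delta_mx 0 j) <->
   derivable g (rV_cons (t, y)) (delta_mx 0 (lift 0 j))) /\
  partial j (g \o (fun y => rV_cons (t, y))) y = partial (lift 0 j) g (rV_cons (t, y)).
Proof.
exact: (@derivable_slice R _ _ _ g (fun y => rV_cons (t, y)) y (delta_mx 0 j)
  (delta_mx 0 (lift 0 j)) (fun h => rV_cons_slice t h y j)).
Qed.

(** Fubini, with the inner integral chosen to contain the variable of differentiation: the line if i
    = 0, the remaining coordinates (by induction) otherwise. *)
Lemma integral_partial0 n (g : 'rV[R]_n -> R) (i : 'I_n) (M : R) :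
  continuous g -> continuous (partial i g) ->
  (forall x, derivable g x (delta_mx 0 i)) -> supp_in M g ->
  (\int[leb n]_x (partial i g x)%:E = 0)%E.
Proof.
elim: n g i => [|n IHn] g i cg cdg dg gM; first by case: (i) => [].

have dgM : supp_in M (partial i g) by exact: partial_supp.
have If := supp_integrable_prod cdg dgM.
transitivity (\int[(@lebesgue_measure R \x leb n)%E]_z (partial i g (rV_cons z))%:E)%E.
  have := @integral_pushforward _ _ _ _ R _ (@measurable_rV_cons R n)
    (@lebesgue_measure R \x leb n)%E setT (fun x => (partial i g x)%:E).
  rewrite preimage_setT; apply => //.
  by apply/measurable_EFinP; exact: rV_continuous_measurable.
case: (unliftP 0 i) => [j|] iE; rewrite iE in cdg dg dgM If *.
  rewrite -(integral12_prod_meas1 If).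
  apply: integral0_eq => t _ /=; rewrite /fubini_F.
  rewrite -[RHS](IHn (g \o (fun y => rV_cons (t, y))) j).
  - apply: eq_integral => y _; congr EFin.
    by rewrite (partial_cons g t y j).2.
  - move=> y; apply: continuous_comp; [exact: rV_cons_continuous2|exact: cg].
  - have -> : partial j (g \o (fun y => rV_cons (t, y))) =
        partial (lift 0 j) g \o (fun y => rV_cons (t, y)).
      apply/funext => y.
      by rewrite (partial_cons g t y j).2.
    move=> y; apply: continuous_comp; [exact: rV_cons_continuous2|exact: cdg].
  - move=> y; apply/(partial_cons g t y j).1.
    exact: dg.
  - move=> y [k yk]; apply: gM; exists (lift 0 k).
    by rewrite rV_cons_lift.
rewrite -(integral21_prod_meas1 If).
apply: integral0_eq => y _ /=; rewrite /fubini_G.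
pose N : R := `|M| + 1.
have NM t : N <= `|t| -> g (rV_cons (t, y)) = 0 /\ partial 0 g (rV_cons (t, y)) = 0.
  move=> Nt; split; [apply: gM|apply: dgM]; exists 0; rewrite rV_cons0.
    by apply: lt_le_trans Nt; rewrite /N; have := ler_norm M; lra.
  by apply: lt_le_trans Nt; rewrite /N; have := ler_norm M; lra.
have N0 : 0 < N by rewrite /N; have := normr_ge0 M; lra.
pose f (t : R) : R := partial 0 g (rV_cons (t, y)); pose F (t : R) : R := g (rV_cons (t, y)).
transitivity (\int[@lebesgue_measure R]_(t in [set` `[- N, N]%R]) (f t)%:E)%E.
  rewrite [RHS]integral_mkcond; apply: eq_integral => t _ /=.
  rewrite /patch; case: ifPn => //; rewrite mem_setE in_itv/= => /negP h.
  rewrite (NM t _).2//; rewrite leNgt; apply/negP; rewrite ltr_norml => /andP[h1 h2].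
  by apply: h; rewrite !ltW.
have dF t : derivable (F : R -> R^o) t 1 /\ 'D_1 (F : R -> R^o) t = f t.
  have [h hE] := @derivable_slice R R^o _ R^o g (fun t : R => rV_cons (t, y)) t 1 (delta_mx 0 0) (fun h => rV_cons_slice0 t h y).
  by split; [apply/h; exact: dg|exact: hE].
have cF : continuous F.
  by move=> t; apply: continuous_comp; [exact: rV_cons_continuous1|exact: cg].
rewrite (@continuous_FTC2 R f F).
- have FN : F N = 0 by apply: (NM N _).1; rewrite ger0_norm// ltW.
  have FN' : F (- N) = 0 by apply: (NM (- N) _).1; rewrite normrN ger0_norm// ltW.
  by rewrite FN FN' subee.
- by lra.
- apply: continuous_subspaceT => t.
  by apply: continuous_comp; [exact: rV_cons_continuous1|exact: cdg].
- split.
  + by move=> t _; exact: (dF t).1.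
  + by apply: cvg_at_right_filter; exact: cF.
  + by apply: cvg_at_left_filter; exact: cF.
- by move=> t _; rewrite derive1E; exact: (dF t).2.
Qed.
End int_partial.

(** * Smooth functions *)

Section flat.
Context (R : realType).

(* [q(1/t) e^(-1/t)]: closed under differentiation, the new polynomial being
   [X^2 (q - q')]; this gives smooth functions with one-sided support. *)
Definition flat (q : {poly R}) (t : R) : R :=
  if 0 < t then q.[t^-1] * expR (- t^-1) else 0.

(** For s > 0 the exponential dominates each single term s^i / i! of its series. *)
Lemma expRN_monomial_bound i (s : R) : 0 < s -> s ^+ i * expR (- s) <= i`!%:R.
Proof.
move=> s0; rewrite expRN ler_pdivrMr ?expR_gt0//.
case: i => [|i]; first by rewrite expr0 mul1r; have := expR_ge1Dx s; lra.
have f0 : 0 < (i.+1)`!%:R :> R by rewrite ltr0n fact_gt0.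
have := expR_ge1Dxn i (ltW s0).
rewrite -(ler_pM2l f0); apply: le_trans.
by rewrite mulrDr mulr1 mulrC divfK ?gt_eqF// lerDr ltW.
Qed.

Lemma poly_expRN_bounded (p : {poly R}) :
  exists K, forall s, 0 < s -> `|p.[s] * expR (- s)| <= K.
Proof.
exists (\sum_(i < size p) `|p`_i| * i`!%:R) => s s0.
rewrite horner_coef mulr_suml; apply: (le_trans (ler_norm_sum _ _ _)).
apply: ler_sum => i _; rewrite -mulrA normrM ler_wpM2l//.
rewrite ger0_norm ?expRN_monomial_bound//.
by rewrite mulr_ge0 ?expR_ge0// exprn_ge0// ltW.
Qed.

(** The bound for ['X^2 * q] at s = 1/t. It makes [flat q] differentiable at 0, with derivative
    0. *)
Lemma flat_quadratic q : exists K, forall t, `|flat q t| <= K * t ^+ 2.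
Proof.
have [K HK] := poly_expRN_bounded ('X^2 * q).
exists K => t; rewrite /flat; case: ifPn => [t0|_]; last first.
  rewrite normr0 mulr_ge0 ?sqr_ge0//.
  (* K is nonnegative since it bounds an absolute value, here at s = 1. *)
  by apply: le_trans (HK 1 _).
have := HK t^-1; rewrite invr_gt0 => /(_ t0).
rewrite hornerM hornerXn exprVn -mulrA normrM ger0_norm ?invr_ge0 ?sqr_ge0//.
by rewrite mulrC ler_pdivrMr ?exprn_gt0.
Qed.

Lemma is_derive_flat q (t : R) :
  is_derive t (1 : R) (flat q) (flat ('X^2 * (q - q^`())) t).
Proof.
have [t0|t0|t0] := ltgtP t 0.
- have -> : flat ('X^2 * (q - q^`())) t = 0 by rewrite /flat ltNge (ltW t0).
  apply: (@near_eq_is_derive R R R (cst 0)).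
  near=> s; rewrite /flat ltNge (_ : s <= 0)//; apply: ltW; near: s.
  exact: lt_nbhsl.
- have -> : flat ('X^2 * (q - q^`())) t =
      q.[t^-1] * (expR (- t^-1) * (t ^- 2)) + expR (- t^-1) * (q^`().[t^-1] * (- t ^- 2)).
    by rewrite /flat t0 hornerM hornerXn hornerD hornerN exprVn; ring.
  apply: (@near_eq_is_derive R R R (fun s => q.[s^-1] * expR (- s^-1))).
    near=> s; rewrite /flat (_ : 0 < s)//; near: s; exact: lt_nbhsr.
  have tn0 : t != 0 by rewrite gt_eqF.
  have dV : is_derive t (1 : R) (fun s : R => s^-1) (- t ^- 2).
    have := @is_deriveV R id t 1 1 tn0 (is_derive_id _ _).
    by rewrite [_ *: 1]mulr1.
  have dq := @is_derive1_comp R (horner q) (fun s => s^-1) t _ _ (is_derive_poly q t^-1) dV.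
  have de := @is_derive1_comp R expR (fun s => - s^-1) t _ _ (is_derive_expR (- t^-1)) (is_deriveN dV).
  have := is_deriveM dq de; rewrite opprK.
  by move=> h; exact: h.
- rewrite t0; have -> : flat ('X^2 * (q - q^`())) 0 = 0 by rewrite /flat ltxx.
  have [K HK] := flat_quadratic q.
  suff h : h^-1 *: ((flat q \o shift 0) (h *: (1 : R)) - flat q 0) @[h --> 0^'] --> (0 : R).
    apply: DeriveDef; first by apply/cvg_ex; exists 0.
    exact: cvg_lim h.
  apply/cvgr0Pnorm_le => e e0; near=> h.
  have h0 : h != 0 by near: h; exact: nbhs_dnbhs_neq.
  rewrite /= addr0 [h *: 1]mulr1 {2}/flat ltxx subr0 normrZ normfV.
  rewrite ler_pdivrMl ?normr_gt0//; apply: (le_trans (HK h)).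
  rewrite -[h ^+ 2]real_normK ?num_real// expr2 mulrA mulrC ler_wpM2l//.
  (* [|K| + 1] replaces K to have a positive divisor. *)
  have hK : `|h| * (`|K| + 1) <= e.
    rewrite -ler_pdivlMr ?ltr_wpDl//; near: h.
    by apply: dnbhs0_le; rewrite divr_gt0// ltr_wpDl.
  apply: le_trans hK; rewrite mulrC ler_wpM2l//.
  by have := ler_norm K; lra.
Unshelve. all: by end_near. Qed.

End flat.
Section smooth.
Context (R : realType) (n : nat).
Implicit Types (f g : 'rV[R]_n -> R).

(* Leibniz' rule: if partial derivatives of the generators are polynomials in the
   generators, the whole algebra consists of smooth functions. *)
Inductive alg_closure (B : set ('rV[R]_n -> R)) : set ('rV[R]_n -> R) :=
| alg_base f : B f -> alg_closure B f
| alg_add f g : alg_closure B f -> alg_closure B g -> alg_closure B (f + g)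
| alg_mul f g : alg_closure B f -> alg_closure B g -> alg_closure B (f * g).

Lemma partialD f g i : (forall x, differentiable f x) -> (forall x, differentiable g x) ->
  partial i (f + g) = partial i f + partial i g.
Proof.
by move=> df dg; apply/funext => x; rewrite /partial deriveD//; exact: diff_derivable.
Qed.

Lemma partialM f g i : (forall x, differentiable f x) -> (forall x, differentiable g x) ->
  partial i (f * g) = f * partial i g + g * partial i f.
Proof.
by move=> df dg; apply/funext => x; rewrite /partial deriveM//; exact: diff_derivable.
Qed.

Lemma alg_closure_smooth B f :
  (forall f, B f -> forall x, differentiable f x) ->
  (forall f i, B f -> alg_closure B (partial i f)) ->
  alg_closure B f -> smooth f.
Proof.
move=> dB pB Bf.
have dA g : alg_closure B g -> forall x, differentiable g x.
  elim=> [g0|g1 g2 _ d1 _ d2 x|g1 g2 _ d1 _ d2 x]; first exact: dB.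
    exact: differentiableD.
  exact: differentiableM.
have pA i g : alg_closure B g -> alg_closure B (partial i g).
  elim=> [g0|g1 g2 A1 p1 A2 p2|g1 g2 A1 p1 A2 p2]; first exact: pB.
    by rewrite partialD; [exact: alg_add|exact: dA|exact: dA].
  rewrite partialM; [|exact: dA|exact: dA].
  by apply: alg_add; exact: alg_mul.
by move=> s x; apply: dA; elim: s => //= i s; exact: pA.
Qed.

Lemma smooth_differentiable f : smooth f -> forall x, differentiable f x.
Proof. by move=> sf x; exact: (sf [::]). Qed.

Lemma smooth_partial f i : smooth f -> smooth (partial i f).
Proof. by move=> sf s x; have := sf (rcons s i) x; rewrite -cats1 foldr_cat. Qed.

(** All smooth functions are taken as generators: their partial derivatives are again generators. *)
Lemma smoothD f g : smooth f -> smooth g -> smooth (f + g).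
Proof.
move=> sf sg; apply: (@alg_closure_smooth (@smooth R n)).
- exact: smooth_differentiable.
- by move=> h i sh; apply: alg_base; exact: smooth_partial.
- by apply: alg_add; exact: alg_base.
Qed.

Lemma smoothM f g : smooth f -> smooth g -> smooth (f * g).
Proof.
move=> sf sg; apply: (@alg_closure_smooth (@smooth R n)).
- exact: smooth_differentiable.
- by move=> h i sh; apply: alg_base; exact: smooth_partial.
- by apply: alg_mul; exact: alg_base.
Qed.

(** A partial derivative of a ridge function is a ridge function with the same affine argument, so
    closure under derivatives becomes a question about h alone. *)
Definition ridge (h : R -> R) (i : 'I_n) (e c : R) : 'rV[R]_n -> R :=
  fun x => h (e * x 0 i + c).

Lemma differentiable_ridge h i e c x :
  (forall t, derivable (h : R -> R^o) t 1) -> differentiable (ridge h i e c) x.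
Proof.
move=> dh; apply: (@differentiable_comp R _ R^o R^o (fun x : 'rV[R]_n => e * x 0 i + c) h).
  apply: (@differentiableD R _ R^o (fun x : 'rV[R]_n => e * x 0 i) (cst c)); last exact: differentiable_cst.
  apply: (@differentiableM R _ (cst e) (fun x : 'rV[R]_n => x 0 i)); first exact: differentiable_cst.
  exact: differentiable_coord.
by apply/derivable1_diffP; exact: dh.
Qed.

Lemma partial_ridge h h' i e c j : (forall t : R, is_derive t (1 : R) (h : R -> R^o) (h' t)) ->
  partial j (ridge h i e c) = ridge (fun t => (e * (i == j)%:R) * h' t) i e c.
Proof.
move=> dh; apply/funext => x; rewrite /partial.
have slice (t : R) : e * (t *: delta_mx 0 j + x) 0 i + c =
    t *: (e * (i == j)%:R : R^o) + (e * x 0 i + c).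
  by rewrite !mxE eqxx/= -[RHS]/(t * (e * (i == j)%:R) + (e * x 0 i + c)); ring.
have [_ ->] := @derivable_slice R 'rV[R]_n R^o R^o h (fun x : 'rV[R]_n => e * x 0 i + c) x
   (delta_mx 0 j) (e * (i == j)%:R) slice.
have dhx := dh (e * x 0 i + c).
have dd : differentiable (h : R -> R^o) (e * x 0 i + c).
  by apply/derivable1_diffP; case: dhx.
rewrite deriveE// /ridge -[X in 'd _ _ X]mulr1 -[X in 'd _ _ X]/(_ *: _) linearZ/=.
rewrite -deriveE//; congr (_ * _); exact: derive_val.
Qed.

(** Polynomials provide the coordinates, [flat] the cutoffs; the scalar [a] absorbs the factor
    produced by the chain rule. *)
Definition smooth1_class : set (R -> R) :=
  [set h | (exists p : {poly R}, h = horner p) \/ exists a q, h = fun t => a * flat q t].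

Lemma smooth1_class_derive h : smooth1_class h ->
  exists2 h', smooth1_class h' & forall t : R, is_derive t (1 : R) (h : R -> R^o) (h' t).
Proof.
move=> [[p ->]|[a [q ->]]].
  exists (horner p^`()); first by left; exists p^`().
  by move=> t; exact: is_derive_poly.
exists (fun t => a * flat ('X^2 * (q - q^`())) t); first by right; do 2 eexists.
by move=> t; have := is_deriveZ a (is_derive_flat q t).
Qed.

Lemma smooth1_classZ a h : smooth1_class h -> smooth1_class (fun t => a * h t).
Proof.
move=> [[p ->]|[b [q ->]]].
  by left; exists (a *: p); apply/funext => t; rewrite hornerZ.
by right; exists (a * b), q; apply/funext => t; rewrite mulrA.
Qed.

Lemma smooth_ridge h i e c : smooth1_class h -> smooth (ridge h i e c).
Proof.
move=> sh; apply: (@alg_closure_smooth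
  [set f | exists h i e c, smooth1_class h /\ f = ridge h i e c]).
- move=> _ [{}h [{}i [{}e [{}c [{}sh ->]]]]] x.
  have [h' _ dh] := smooth1_class_derive sh.
  by apply: differentiable_ridge => t; case: (dh t).
- move=> _ j [{}h [{}i [{}e [{}c [{}sh ->]]]]].
  have [h' sh' dh] := smooth1_class_derive sh.
  apply: alg_base; rewrite (partial_ridge _ _ _ _ dh).
  exists (fun t => e * (i == j)%:R * h' t), i, e, c.
  by split => //; exact: smooth1_classZ.
- by apply: alg_base; exists h, i, e, c.
Qed.

Lemma partial_cst (a : R) i : partial i (cst a : 'rV[R]_n -> R) = cst 0.
Proof. by apply/funext => x; rewrite /partial derive_cst. Qed.

Lemma smooth_cst (a : R) : smooth (cst a : 'rV[R]_n -> R).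
Proof.
apply: (@alg_closure_smooth [set f | exists a, f = cst a]).
- by move=> _ [b ->] x; exact: differentiable_cst.
- by move=> _ i [b ->]; apply: alg_base; exists 0; rewrite partial_cst.
- by apply: alg_base; exists a.
Qed.

Lemma smooth_coord i : smooth (fun x : 'rV[R]_n => x 0 i).
Proof.
have -> : (fun x : 'rV[R]_n => x 0 i) = ridge (horner 'X) i 1 0.
  by apply/funext => x; rewrite /ridge hornerX mul1r addr0.
by apply: smooth_ridge; left; exists 'X.
Qed.

Lemma smooth_sum (I : Type) (r : seq I) (P : pred I) (f : I -> 'rV[R]_n -> R) :
  (forall i, P i -> smooth (f i)) -> smooth (fun x => \sum_(i <- r | P i) f i x).
Proof.
move=> sf; have -> : (fun x => \sum_(i <- r | P i) f i x) = \sum_(i <- r | P i) f i.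
  by apply/funext => x; rewrite fct_sumE.
elim/big_ind : _ => //; [exact: smooth_cst|exact: smoothD].
Qed.

Lemma smooth_continuous f : smooth f -> continuous f.
Proof. by move=> sf x; exact/differentiable_continuous/smooth_differentiable. Qed.

End smooth.

(** * Cutoff functions and the fundamental lemma of the calculus of variations *)

Section bump.
Context (R : realType) (n : nat).
Implicit Types (a b x : 'rV[R]_n).

Lemma flat1_ge0 (t : R) : 0 <= flat 1 t.
Proof. by rewrite /flat; case: ifPn => // _; rewrite hornerC mul1r expR_ge0. Qed.

Lemma flat1_le1 (t : R) : flat 1 t <= 1.
Proof.
by rewrite /flat; case: ifPn => // t0; rewrite hornerC mul1r expR_le1 oppr_le0 invr_ge0 ltW.
Qed.

Lemma flat1_gt0 (t : R) : 0 < t -> 0 < flat 1 t.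
Proof. by move=> t0; rewrite /flat t0 hornerC mul1r expR_gt0. Qed.

Lemma flat1_eq0 (t : R) : t <= 0 -> flat 1 t = 0.
Proof. by move=> t0; rewrite /flat ltNge t0. Qed.

Definition bump a b x : R :=
  \prod_i (flat 1 (x 0 i - a 0 i) * flat 1 (b 0 i - x 0 i)).

(* Increases with [m] to the indicator of the open box. *)
Definition cutoff a b (m : nat) x : R := 1 - (1 - bump a b x) ^+ m.

Lemma bump_ge0 a b x : 0 <= bump a b x.
Proof. by apply: prodr_ge0 => i _; rewrite mulr_ge0 ?flat1_ge0. Qed.

Lemma bump_le1 a b x : bump a b x <= 1.
Proof.
apply: prodr_ile1 => i _; rewrite mulr_ge0 ?flat1_ge0//=.
by rewrite mulr_ile1 ?flat1_ge0 ?flat1_le1.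
Qed.

Lemma bump_gt0 a b x : obox a b x -> 0 < bump a b x.
Proof.
move=> h; apply: prodr_gt0 => i _.
by have /andP[h1 h2] := h i; rewrite mulr_gt0// flat1_gt0// subr_gt0.
Qed.

Lemma bump_eq0 a b x : ~ obox a b x -> bump a b x = 0.
Proof.
move=> /existsNP[i /negP]; rewrite negb_and -!leNgt => h.
apply/eqP/prodf_eq0; exists i => //; apply/eqP; case/orP: h => h.
  by rewrite flat1_eq0 ?mul0r// subr_le0.
by rewrite [X in _ * X]flat1_eq0 ?mulr0// subr_le0.
Qed.

Lemma cutoff_ge0 a b m x : 0 <= cutoff a b m x.
Proof.
have := bump_ge0 a b x; have := bump_le1 a b x => h1 h0.
by rewrite subr_ge0 exprn_ile1//; lra.
Qed.

Lemma cutoff_le1 a b m x : cutoff a b m x <= 1.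
Proof.
have := bump_ge0 a b x; have := bump_le1 a b x => h1 h0.
by rewrite gerBl exprn_ge0//; lra.
Qed.

Lemma cutoff_eq0 a b m x : ~ obox a b x -> cutoff a b m x = 0.
Proof. by move=> h; rewrite /cutoff bump_eq0// subr0 expr1n subrr. Qed.

Lemma cutoff_cvg a b x :
  (fun m => cutoff a b m x) @ \oo --> (\1_(obox a b) x : R).
Proof.
rewrite indicE; case: (boolP (x \in _)) => [/set_mem xB|/negP xB]; last first.
  have -> : (fun m => cutoff a b m x) = cst 0.
    by apply/funext => m; rewrite cutoff_eq0// => h; apply: xB; rewrite inE.
  exact: cvg_cst.
have h0 := bump_gt0 xB; have h1 := bump_le1 a b x.
have : (fun m => (1 - bump a b x) ^+ m) @ \oo --> (0 : R).
  by apply: cvg_expr; rewrite ger0_norm; lra.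
rewrite -[X in _ --> X]subr0 => h; apply: cvgB; first exact: cvg_cst.
exact: h.
Qed.

Lemma smooth_prod (I : Type) (r : seq I) (P : pred I) (f : I -> 'rV[R]_n -> R) :
  (forall i, P i -> smooth (f i)) -> smooth (fun x => \prod_(i <- r | P i) f i x).
Proof.
move=> sf; elim: r => [|i r IHr].
  by under eq_fun do rewrite big_nil; exact: smooth_cst.
case Pi: (P i); under eq_fun do rewrite big_cons Pi; last by [].
exact: smoothM (sf _ Pi) IHr.
Qed.

Lemma smooth_bump a b : smooth (bump a b).
Proof.
apply: smooth_prod => i _.
have sf (e c : R) : smooth (ridge (fun t => 1 * flat 1 t) i e c).
  by apply: smooth_ridge; right; exists 1, 1.
have -> : (fun x => flat 1 (x 0 i - a 0 i) * flat 1 (b 0 i - x 0 i)) =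
    ridge (fun t => 1 * flat 1 t) i 1 (- a 0 i) *
    ridge (fun t => 1 * flat 1 t) i (-1) (b 0 i).
  apply/funext => x; rewrite -[RHS]/(_ x * _ x) /ridge !mul1r mulN1r.
  by rewrite (addrC (- x 0 i)).
exact: smoothM.
Qed.

Lemma smooth_cutoff a b m : smooth (cutoff a b m).
Proof.
have s1 : smooth (fun x => 1 - bump a b x).
  have -> : (fun x => 1 - bump a b x) = cst 1 + cst (-1) * bump a b.
    by apply/funext => x; rewrite -[RHS]/(1 + (-1) * bump a b x) mulN1r.
  by apply: smoothD; [exact: smooth_cst|apply: smoothM; [exact: smooth_cst|exact: smooth_bump]].
have sm : smooth (fun x => (1 - bump a b x) ^+ m).
  elim: m => [|m IHm]; first exact: smooth_cst.
  by under eq_fun do rewrite exprS; exact: smoothM s1 IHm.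
have -> : cutoff a b m = cst 1 + cst (-1) * (fun x => (1 - bump a b x) ^+ m).
  by apply/funext => x; rewrite -[RHS]/(1 + (-1) * (_ ^+ m)) mulN1r.
by apply: smoothD; [exact: smooth_cst|apply: smoothM => //; exact: smooth_cst].
Qed.

Lemma obox_cbox a b : obox a b `<=` cbox a b.
Proof. by move=> x h i; have /andP[/ltW -> /ltW ->] := h i. Qed.

End bump.

Section fundamental.
Context (R : realType) (n : nat).
Notation mu := (lebesgue_rV R n).
Implicit Types (a b x : 'rV[R]_n) (D : set 'rV[R]_n).

Lemma measurable_obox a b : measurable (obox a b).
Proof. by apply: rV_open_measurable; exact: obox_open. Qed.

(** Dominated convergence with majorant |f|: the cutoffs have values in [0, 1] and tend to the
    indicator of the box. *)
Lemma integral_obox_eq0 D (f : 'rV[R]_n -> R) a b : measurable D ->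
  mu.-integrable D (EFin \o f) -> obox a b `<=` D ->
  (forall m, (\int[mu]_(x in D) (f x * cutoff a b m x)%:E = 0)%E) ->
  (\int[mu]_(x in obox a b) (f x)%:E = 0)%E.
Proof.
move=> mD fi BD f0.
have mf : measurable_fun D f by apply/measurable_EFinP; exact: measurable_int fi.
have mc m : measurable_fun D (cutoff a b m).
  by apply: measurable_funTS; apply: rV_continuous_measurable; exact/smooth_continuous/smooth_cutoff.
have H1 m : measurable_fun D (fun x => (f x * cutoff a b m x)%:E).
  by apply/measurable_EFinP; exact: measurable_funM.
have H2 : measurable_fun D (fun x => (f x * \1_(obox a b) x)%:E).
  apply/measurable_EFinP; apply: measurable_funM => //.
  by apply: measurable_indic; exact: measurable_obox.
have H3 : \forall x \ae mu, D x ->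
    (f x * cutoff a b m x)%:E @[m --> \oo] --> (f x * \1_(obox a b) x)%:E.
  apply: aeW => x Dx; apply: cvg_EFin; first exact: nearW.
  by apply: cvgM; [exact: cvg_cst|exact: cutoff_cvg].
have H4 : mu.-integrable D (fun x => `|(f x)%:E|%E) by exact: integrable_abse.
have H5 : \forall x \ae mu, forall m : nat, D x ->
    (`|(f x * cutoff a b m x)%:E| <= `|(f x)%:E|)%E.
  apply: aeW => x m _; rewrite !abse_EFin lee_fin normrM.
  by rewrite ler_piMr// ger0_norm ?cutoff_ge0 ?cutoff_le1.
have [_ _] := dominated_convergence mD H1 H2 H3 H4 H5.
have -> : [sequence (\int[mu]_(x in D) (f x * cutoff a b m x)%:E)%E]_m = cst 0%E.
  by apply/funext => m; exact: f0.
move=> /(cvg_unique _ (cvg_cst _)) h.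
rewrite -(setIidr BD) integral_mkcondr [RHS]h//.
apply: eq_integral => x _; rewrite /patch indicE.
by case: (x \in obox a b); rewrite ?mulr1 ?mulr0.
Qed.

(** The sets A with zero integral over the intersection of B and A form a Dynkin system containing
    all boxes. Staying inside one box B puts the whole space in that system. *)
Lemma integral_setI_obox_eq0 (f : 'rV[R]_n -> \bar R) a b : 
  mu.-integrable (obox a b) f ->
  (forall a' b', obox a' b' `<=` obox a b -> (\int[mu]_(x in obox a' b') f x = 0)%E) ->
  forall A, measurable A -> (\int[mu]_(x in obox a b `&` A) f x = 0)%E.
Proof.
set B := obox a b => fi f0 A mA; have mB : measurable B by exact: measurable_obox.
have fiS E : measurable E -> mu.-integrable (B `&` E) f.
  move=> mE; apply: (integrableS mB) => //; exact: measurableI.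
pose P := [set A | (\int[mu]_(x in B `&` A) f x = 0)%E].
apply: (@dynkin_induction _ _ [set obox p.1 p.2 | p in [set: 'rV[R]_n * 'rV[R]_n]] P).
- exact: rV_measurableE.
- move=> _ _ [[a1 b1] _ <-] [[a2 b2] _ <-]; rewrite oboxI.
  by exists (\row_i Num.max (a1 0 i) (a2 0 i), \row_i Num.min (b1 0 i) (b2 0 i)).
- by rewrite /P/= setIT; exact: f0.
- move=> _ [[a1 b1] _ <-]; rewrite /P/= /B oboxI; apply: f0.
  by rewrite -oboxI; exact: subIsetl.
- move=> S mS; rewrite /P/= => S0.
  have : (\int[mu]_(x in B) f x = 0)%E by exact: f0.
  rewrite -{1}(setIT B) -(setUv S) setIUr integral_setU.
  + by rewrite S0 add0e.
  + exact: measurableI.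
  + by apply: measurableI => //; exact: measurableC.
  + by rewrite -setIUr setUv setIT; exact: measurable_int fi.
  + by apply/disj_setPS => x [[_ ?] [_]].
- move=> F mF tF; rewrite /P/= => F0; rewrite setI_bigcupr integral_bigcup.
  + by apply: eseries0 => i _ _; exact: F0.
  + exact: trivIset_setIl.
  + by move=> k; exact: measurableI.
  + by rewrite -setI_bigcupr; apply: fiS; exact: bigcupT_measurable.
- by rewrite -rV_measurableE.
Qed.

Lemma ae0_obox D (f : 'rV[R]_n -> R) a b : measurable D ->
  mu.-integrable D (EFin \o f) -> obox a b `<=` D ->
  (forall a' b' m, obox a' b' `<=` obox a b ->
    (\int[mu]_(x in D) (f x * cutoff a' b' m x)%:E = 0)%E) ->
  mu.-negligible [set x | obox a b x /\ f x != 0].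
Proof.
move=> mD fi BD f0; have mB := measurable_obox a b.
have fiB : mu.-integrable (obox a b) (EFin \o f) by exact: integrableS fi.
have h : ae_eq mu (obox a b) (EFin \o f) (cst 0%E).
  apply: integral_ae_eq => // E EB mE; rewrite integral0.
  rewrite -(setIidr EB); apply: integral_setI_obox_eq0 => // a' b' B'B.
  apply: (integral_obox_eq0 mD fi) => [|m]; last exact: f0.
  exact: subset_trans BD.
move: h; apply: negligibleS => x /= [Bx fx0]; apply/not_implyP; split => //.
by move=> [] /eqP; rewrite (negbTE fx0).
Qed.

(** The compact set K records that each cutoff is a legitimate coefficient of a test form on D.
    Countably many rational cubes with closure in D cover D. *)
Lemma ae0_of_cutoff D (f : 'rV[R]_n -> R) : open D ->
  mu.-integrable D (EFin \o f) ->
  (forall K a b m, compact K -> K `<=` D -> obox a b `<=` K ->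
    (\int[mu]_(x in D) (f x * cutoff a b m x)%:E = 0)%E) ->
  mu.-negligible [set x | D x /\ f x != 0].
Proof.
move=> oD fi f0; have mD := rV_open_measurable oD.
pose F k : set 'rV[R]_n := if (choice.unpickle k : option ('rV[rat]_n * rat)) is Some p then
  [set x | [/\ crbox p `<=` D, rbox p x & f x != 0]] else set0.
have DF : [set x | D x /\ f x != 0] `<=` \bigcup_k F k.
  move=> x [+ fx]; rewrite {1}(open_bigcup_rbox oD) => -[p pD px].
  by exists (choice.pickle p) => //; rewrite /F choice.pickleK.
apply: negligibleS DF _; apply: negligible_bigcup => k; rewrite /F.
case: choice.unpickle => [p|]; last exact: negligible_set0.
have [pD|pD] := pselect (crbox p `<=` D); last first.
  by apply: negligibleS (negligible_set0 _) => x [].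
have : mu.-negligible [set x | rbox p x /\ f x != 0].
  apply: (ae0_obox mD fi); first exact: subset_trans (@obox_cbox _ _ _ _) pD.
  (* The closed cube serves as K for all boxes inside the open one. *)
  move=> a b m ab; apply: (f0 (crbox p)) => //; first exact: compact_cbox.
  exact: subset_trans ab (@obox_cbox _ _ _ _).
by apply: negligibleS => x [].
Qed.

End fundamental.

(** * Algebra of the Koszul and Hodge operators *)

Section exterior.
Context (R : realType) (n : nat).
Implicit Types (S A : {set 'I_n}) (i j : 'I_n) (a b c e t : covector R n) (x y : 'rV[R]_n).

Lemma covectorZE (r : R) a S : (r *: a) S = r * a S.
Proof. by rewrite ffunE. Qed.

(* [y^flat /\ e], the adjoint of [koszul y]; up to sign it is star kappa star. *)
Definition eps y e : covector R n :=
  [ffun S : {set 'I_n} => \sum_(i in S) sgn R i S * y 0 i * e (S :\ i)].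

Lemma sgnD1 i S : sgn R i (S :\ i) = sgn R i S.
Proof.
rewrite /sgn; congr (_ ^+ _); apply: eq_card => j; rewrite !inE.
by case: ltngtP; rewrite ?andbF ?andbT// => ji; rewrite -val_eqE/= ltn_eqF.
Qed.

Lemma sgnU1 i S : sgn R i (i |: S) = sgn R i S.
Proof.
rewrite /sgn; congr (_ ^+ _); apply: eq_card => j; rewrite !inE.
by case: ltngtP; rewrite ?andbF ?andbT// => ji; rewrite -val_eqE/= ltn_eqF.
Qed.

Lemma sgn_sqr i S : sgn R i S * sgn R i S = 1.
Proof. by rewrite /sgn -expr2 sqrr_sign. Qed.

Lemma hodge_sgn_sqr S : hodge_sgn R S * hodge_sgn R S = 1.
Proof. by rewrite /hodge_sgn -expr2 sqrr_sign. Qed.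

Lemma cdot_eps y e t : cdot (eps y e) t = cdot e (koszul y t).
Proof.
rewrite /cdot.
transitivity (\sum_i \sum_(S : {set 'I_n} | i \in S) sgn R i S * y 0 i * e (S :\ i) * t S).
  rewrite (exchange_big_dep xpredT)//=; apply: eq_bigr => S _.
  by rewrite ffunE mulr_suml.
transitivity (\sum_i \sum_(S : {set 'I_n} | i \notin S) e S * (sgn R i S * y 0 i * t (i |: S))).
  apply: eq_bigr => i _.
  (* Removing i matches the sets that contain i with those that do not. *)
  rewrite [RHS](reindex_onto (fun S => S :\ i) (fun S => i |: S)) /=; last first.
    by move=> S iS; rewrite finset.setU1K.
  apply: eq_big => S.
    rewrite finset.setD11 /=; apply/idP/eqP => [iS|<-]; first exact: finset.setD1K.
    by rewrite finset.setU11.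
  by move=> iS; rewrite finset.setD1K// sgnD1; ring.
rewrite [RHS](eq_bigr (fun S => \sum_(i | i \notin S) e S * (sgn R i S * y 0 i * t (i |: S)))).
  by rewrite [RHS](exchange_big_dep xpredT).
by move=> S _; rewrite ffunE mulr_sumr.
Qed.

Lemma card_split_lt i S : (#|S| = #|[set j in S | (j < i)%N]%SET| +
  #|[set j in S | (i < j)%N]%SET| + (i \in S))%N.
Proof.
rewrite -(cardsID [set j : 'I_n | (j < i)%N]%SET S) -addnA; congr (_ + _)%N.
  by apply: eq_card => j; rewrite !inE.
rewrite (cardsD1 i) addnC; congr (_ + _)%N; last by rewrite !inE ltnn.
apply: eq_card => j; rewrite !inE -val_eqE/= -leqNgt ltn_neqAle eq_sym.
by case: (j \in S); rewrite ?andbF// andbT.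
Qed.

(* Moving [i] into [A] changes the number of inversions of the pair (A, ~: A) by
   the elements of [~: A] below [i] minus those of [A] above [i]. *)
Lemma hodge_sgnU1 i A : i \notin A ->
  hodge_sgn R A * sgn R i A = (-1) ^+ #|A| * sgn R i (~: A) * hodge_sgn R (i |: A).
Proof.
move=> iA.
pose inv A : nat := #|[set p : 'I_n * 'I_n | [&& p.1 \in A, p.2 \notin A & (p.2 < p.1)%N]]%SET|.
(* The inversions that do not involve i, common to A and [i |: A]. *)
pose X := [set p : 'I_n * 'I_n | [&& p.1 \in A, p.2 \notin A, p.2 != i & (p.2 < p.1)%N]]%SET.
have invA : inv A = (#|X| + #|[set j in A | (i < j)%N]%SET|)%N.
  rewrite /inv -(cardsID [set p : 'I_n * 'I_n | p.2 != i]%SET); congr (_ + _)%N.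
    by apply: eq_card => p; rewrite !inE; case: (p.1 \in A); case: (p.2 \in A); case: (p.2 != i) => //=; rewrite ?andbT ?andbF.
  rewrite -(card_imset [set j in A | (i < j)%N]%SET (f := fun j => (j, i))); last by move=> j k [].
  apply: eq_card => -[p q]; rewrite !inE/=; apply/idP/imsetP.
    move=> /and4P[/negPn/eqP -> pA _ qp]; exists p => //; by rewrite inE pA.
  by move=> [j]; rewrite inE => /andP[jA ij] [-> ->]; rewrite eqxx jA iA.
have invU : inv (i |: A) = (#|X| + #|[set j in ~: A | (j < i)%N]%SET|)%N.
  rewrite /inv -(cardsID [set p : 'I_n * 'I_n | p.1 != i]%SET); congr (_ + _)%N.
    apply: eq_card => p; rewrite !inE; case: eqVneq => [->|pi] /=.
      by rewrite (negbTE iA)/= !andbF.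
    by rewrite negb_or andbT; case: (p.1 \in A); case: (p.2 \in A); case: (p.2 != i).
  rewrite -(card_imset [set j in ~: A | (j < i)%N]%SET (f := fun j => (i, j))); last by move=> j k [].
  apply: eq_card => -[p q]; rewrite !inE/=; apply/idP/imsetP.
    move=> /and4P[/negPn/eqP -> _]; rewrite negb_or => /andP[qi qA] qp; exists q => //.
    by rewrite !inE qA.
  move=> [j]; rewrite !inE => /andP[jA ji] [-> ->]; rewrite eqxx/= negb_or jA ji andbT.
  by rewrite -val_eqE/= ltn_eqF.
rewrite /hodge_sgn -/(inv A) -/(inv (i |: A)) invA invU (card_split_lt i A) (negbTE iA) addn0.
rewrite /sgn !exprD; set u := (-1) ^+ #|[set j in A | (j < i)%N]%SET|.
set v := (-1) ^+ #|[set j in ~: A | (j < i)%N]%SET|.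
have v2 : v * v = 1 by rewrite /v -expr2 sqrr_sign.
by set z := (-1) ^+ #|X|; set s := (-1) ^+ _; rewrite -[LHS]mulr1 -v2; ring.
Qed.

(** Term by term this is [hodge_sgnU1] at the complement of S. The degree of b fixes the sign. *)
Lemma hodge_koszul x m b : kcovector m.+1 b ->
  hodge (koszul x b) = (-1) ^+ m *: eps x (hodge b).
Proof.
move=> bm; apply/ffunP => S; rewrite !ffunE.
rewrite mulr_sumr [RHS]mulr_sumr; apply: eq_big => [i|i]; first by rewrite inE negbK.
rewrite inE negbK => iS; rewrite ffunE.
have SE : ~: (S :\ i) = i |: ~: S.
  by apply/setP => j; rewrite !inE negb_and negbK.
(* Off degree, b vanishes on [i |: ~: S], which has one element more than [~: S]. *)
rewrite SE; have [cS|cS] := eqVneq #|~: S|%SET m; last first.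
  by rewrite bm ?mulr0 ?mulr0// cardsU1 inE iS/= add1n eqSS.
have iS' : i \notin ~: S by rewrite inE iS.
have := hodge_sgnU1 iS'; rewrite cS finset.setCK => h.
by rewrite !mulrA h; ring.
Qed.

Lemma hodge_kcovector k m a : (m + k)%N = n -> kcovector m a -> kcovector k (hodge a).
Proof.
move=> mk am S Sk; rewrite ffunE am ?mulr0//.
apply: contra Sk => /eqP h; move: (cardsC S); rewrite h card_ord => hS.
by apply/eqP; apply: (@addnI m); rewrite mk addnC.
Qed.

(** A right inverse of [hodge], written out because star star carries a sign that depends on the
    degree. *)
Definition unhodge e : covector R n := [ffun A : {set 'I_n} => hodge_sgn R A * e (~: A)].

Lemma unhodgeK e : hodge (unhodge e) = e.
Proof.
by apply/ffunP => S; rewrite !ffunE finset.setCK mulrA hodge_sgn_sqr mul1r.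
Qed.

Lemma unhodge_kcovector k m a : (m + k)%N = n -> kcovector k a -> kcovector m (unhodge a).
Proof.
move=> mk am S Sk; rewrite ffunE am ?mulr0//.
apply: contra Sk => /eqP h; move: (cardsC S).
by rewrite h card_ord => hS; apply/eqP/(@addIn k); rewrite mk.
Qed.

Lemma kcovectorD k a b : kcovector k a -> kcovector k b -> kcovector k (a + b).
Proof. by move=> ha hb S Sk; rewrite ffunE ha// hb// addr0. Qed.

Lemma kcovectorZ k (r : R) a : kcovector k a -> kcovector k (r *: a).
Proof. by move=> ha S Sk; rewrite covectorZE ha// mulr0. Qed.

Lemma kcovector_koszul k y b : kcovector k.+1 b -> kcovector k (koszul y b).
Proof.
move=> bk S Sk; rewrite ffunE big1// => i iS.
by rewrite bk ?mulr0// cardsU1 iS add1n eqSS.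
Qed.

Lemma kcovector_eps k y e : kcovector k e -> kcovector k.+1 (eps y e).
Proof.
move=> ek S Sk; rewrite ffunE big1// => i iS.
by rewrite ek ?mulr0//; move: Sk; rewrite (cardsD1 i) iS add1n eqSS.
Qed.

Lemma hodgeD a b : hodge (a + b) = hodge a + hodge b.
Proof. by apply/ffunP => S; rewrite !ffunE mulrDr. Qed.

Lemma epsZ y (r : R) e : eps y (r *: e) = r *: eps y e.
Proof.
apply/ffunP => S; rewrite covectorZE !ffunE mulr_sumr; apply: eq_bigr => i _.
by rewrite covectorZE mulrCA.
Qed.

Lemma koszulD y a b : koszul y (a + b) = koszul y a + koszul y b.
Proof.
by apply/ffunP => S; rewrite !ffunE -big_split/=; apply: eq_bigr => i _; rewrite ffunE mulrDr.
Qed.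

Lemma koszulZ y (r : R) b : koszul y (r *: b) = r *: koszul y b.
Proof.
apply/ffunP => S; rewrite covectorZE !ffunE mulr_sumr; apply: eq_bigr => i _.
by rewrite covectorZE mulrCA.
Qed.

Lemma koszulBl y y' b : koszul (y - y') b = koszul y b - koszul y' b.
Proof.
apply/ffunP => S; rewrite !ffunE -sumrB; apply: eq_bigr => i _.
by rewrite !mxE mulrBr mulrBl.
Qed.

Lemma epsBl y y' b : eps (y - y') b = eps y b - eps y' b.
Proof.
apply/ffunP => S; rewrite !ffunE -sumrB; apply: eq_bigr => i _.
by rewrite !mxE mulrBr mulrBl.
Qed.

(** In this form the codifferential is constant and the pairing reduces to contractions by
    [cdot_eps]. The bound on k makes the truncated subtraction [n - k.+1] exact. *)
Lemma P1smP k (eta : dform R n) : (k < n)%N -> P1sm k.+1 eta <->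
  exists c e, [/\ kcovector k.+1 c, kcovector k e & eta = fun x => c + eps x e].
Proof.
move=> kn; have mk : ((n - k.+1) + k.+1)%N = n by rewrite subnK.
have mk' : ((n - k.+1).+1 + k)%N = n by rewrite addSnnS.
split.
  move=> [_ [a [b [ka kb ->]] <-]].
  exists (hodge a), ((-1) ^+ (n - k.+1) *: hodge b); split.
  - exact: hodge_kcovector ka.
  - by apply: kcovectorZ; exact: hodge_kcovector kb.
  - by apply/funext => x; rewrite hodgeD (hodge_koszul x kb) epsZ.
move=> [c [e [kc ke ->]]].
exists (fun x => unhodge c + koszul x ((-1) ^+ (n - k.+1) *: unhodge e)).
  exists (unhodge c), ((-1) ^+ (n - k.+1) *: unhodge e); split => //.
    exact: unhodge_kcovector kc.
  by apply: kcovectorZ; exact: unhodge_kcovector ke.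
apply/funext => x; rewrite hodgeD unhodgeK koszulZ.
have -> : hodge ((-1) ^+ (n - k.+1) *: koszul x (unhodge e)) =
    (-1) ^+ (n - k.+1) *: hodge (koszul x (unhodge e)).
  by apply/ffunP => S; rewrite covectorZE !ffunE mulrCA.
rewrite (hodge_koszul x (unhodge_kcovector mk' ke)) unhodgeK scalerA.
by rewrite -expr2 sqrr_sign scale1r.
Qed.

End exterior.

(** * Integration by parts for forms *)

Section form_calculus.
Context (R : realType) (n : nat).
Implicit Types (S : {set 'I_n}) (i j : 'I_n) (a b c e : covector R n) (x y : 'rV[R]_n).
Implicit Types (mu eta : dform R n).

Definition smooth_form eta := forall S, smooth (fun x => eta x S).

Lemma partial_affine (P : pred 'I_n) (c : R) (d : 'I_n -> R) i x :
  partial i (fun y : 'rV[R]_n => c + \sum_(j | P j) d j * y 0 j) x = if P i then d i else 0.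
Proof.
pose f (y : 'rV[R]_n) : R^o := c + \sum_(j | P j) d j * y 0 j.
have slice (h : R) : f (h *: delta_mx 0 i + x) = h *: ((if P i then d i else 0) : R^o) + f x.
  rewrite /f addrCA; congr (_ + _).
  under eq_bigr do rewrite !mxE mulrDr.
  rewrite big_split/=; congr (_ + _).
  rewrite big_mkcond (bigD1 i)//= big1 => [|j ji]; last first.
    by rewrite (negbTE ji) !mulr0 if_same.
  by rewrite addr0 eqxx mulr1 -[RHS]/(_ * _); case: ifP => _; rewrite ?mulr0// mulrC.
have [_] := @derivable_slice R _ R^o R^o id f x (delta_mx 0 i) _ slice.
by rewrite derive_id.
Qed.

Lemma smooth_affine (P : pred 'I_n) (c : R) (d : 'I_n -> R) :
  smooth (fun y : 'rV[R]_n => c + \sum_(j | P j) d j * y 0 j).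
Proof.
apply: (@smoothD _ _ (cst c) (fun y : 'rV[R]_n => \sum_(j | P j) d j * y 0 j)).
  exact: smooth_cst.
apply: smooth_sum => j _; apply: (@smoothM _ _ (cst (d j)) (fun y : 'rV[R]_n => y 0 j)).
  exact: smooth_cst.
exact: smooth_coord.
Qed.

Lemma P1m_coefE a b y S : (a + koszul y b) S =
  a S + \sum_(j | j \notin S) (sgn R j S * b (j |: S)) * y 0 j.
Proof. by rewrite !ffunE; congr (_ + _); apply: eq_bigr => j _; rewrite mulrAC. Qed.

Lemma P1sm_coefE a b y S : (a + eps y b) S =
  a S + \sum_(j | j \in S) (sgn R j S * b (S :\ j)) * y 0 j.
Proof. by rewrite !ffunE; congr (_ + _); apply: eq_bigr => j _; rewrite mulrAC. Qed.

Lemma smooth_P1m a b : smooth_form (fun y => a + koszul y b).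
Proof. by move=> S; under eq_fun do rewrite P1m_coefE; exact: smooth_affine. Qed.

(** Each of the k + 1 elements i of S contributes b S once, the two signs [sgn] cancelling. *)
Lemma ext_d_P1m k a b : kcovector k.+1 b ->
  ext_d (fun y => a + koszul y b) = fun=> k.+1%:R *: b.
Proof.
move=> kb; apply/funext => x; apply/ffunP => S; rewrite covectorZE ffunE.
have [Sk|Sk] := eqVneq #|S| k.+1; last first.
  rewrite kb// mulr0 big1// => i iS; under eq_fun do rewrite P1m_coefE.
  rewrite partial_affine finset.setD11/= finset.setD1K//.
  by rewrite kb ?mulr0.
rewrite -Sk mulr_natl -sumr_const; apply: eq_bigr => i iS.
under eq_fun do rewrite P1m_coefE.
by rewrite partial_affine finset.setD11/= finset.setD1K// sgnD1 mulrA sgn_sqr mul1r.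
Qed.

(** Here the contributions come from the n - k indices outside S. *)
Lemma codiff_P1sm k c e : kcovector k e ->
  codiff (fun y => c + eps y e) = fun=> - (n - k)%:R *: e.
Proof.
move=> ke; apply/funext => x; apply/ffunP => S; rewrite covectorZE ffunE mulNr; congr (- _).
have [Sk|Sk] := eqVneq #|S| k; last first.
  rewrite ke// mulr0 big1// => i iS; under eq_fun do rewrite P1sm_coefE.
  by rewrite partial_affine finset.setU11/= finset.setU1K// ke ?mulr0.
have -> : (n - k)%N = #|[pred i | i \notin S]|.
  have := cardC (mem S); rewrite Sk card_ord => h; apply: (@addnI k).
  rewrite subnKC; last by rewrite -[leqRHS]h leq_addr.
  by rewrite -[LHS]h; congr (_ + _)%N; apply: eq_card => i; rewrite !inE.
rewrite mulr_natl -sumr_const; apply: eq_bigr => i iS.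
under eq_fun do rewrite P1sm_coefE.
by rewrite partial_affine finset.setU11/= finset.setU1K// sgnU1 mulrA sgn_sqr mul1r.
Qed.

Lemma smooth_ext_d mu : smooth_form mu -> smooth_form (ext_d mu).
Proof.
move=> sm S; under eq_fun do rewrite ffunE.
apply: smooth_sum => i iS.
apply: (@smoothM _ _ (cst (sgn R i S)) (partial i (fun y => mu y (S :\ i)))).
  exact: smooth_cst.
by apply: smooth_partial; exact: sm.
Qed.

Lemma smooth_codiff mu : smooth_form mu -> smooth_form (codiff mu).
Proof.
move=> sm S; under eq_fun do rewrite ffunE -mulN1r.
apply: (@smoothM _ _ (cst (-1))); first exact: smooth_cst.
apply: smooth_sum => i iS.
apply: (@smoothM _ _ (cst (sgn R i S)) (partial i (fun y => mu y (i |: S)))).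
  exact: smooth_cst.
by apply: smooth_partial; exact: sm.
Qed.

Lemma smooth_cdot mu eta : smooth_form mu -> smooth_form eta ->
  smooth (fun x => cdot (mu x) (eta x)).
Proof.
move=> sm se; apply: smooth_sum => S _.
exact: (@smoothM _ _ (fun x => mu x S) (fun x => eta x S)).
Qed.

Lemma codiff_supp eta (K : set 'rV[R]_n) x : closed K -> (forall x, ~ K x -> eta x = 0) ->
  ~ K x -> codiff eta x = 0.
Proof.
move=> cK e0 Kx; apply/ffunP => S; rewrite !ffunE big1 ?oppr0// => i iS.
rewrite /partial (@near_eq_derive _ _ _ _ (cst 0)) ?derive_cst ?mulr0//.
have : open_nbhs x (~` K) by split => //; exact: closed_openC.
move=> /open_nbhs_nbhs; apply: (@filterS _ (nbhs x)) => y Ky.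
by rewrite e0// ffunE.
Qed.

(** A single M for all functions supported in K: both pairings and all fluxes of the integration by
    parts share it. *)
Lemma compact_supp_in (K : set 'rV[R]_n) : compact K ->
  exists M, forall f : 'rV[R]_n -> R, (forall x, ~ K x -> f x = 0) -> supp_in M f.
Proof.
move=> /compact_bounded[M [_ HM]]; exists (M + 1) => f f0 x [j xj].
apply: f0 => Kx; have : `|x| <= M + 1 by apply: HM Kx; rewrite ltrDl.
move=> xM; have : `|x 0 j| <= `|x|.
  by rewrite [leRHS]mx_normrE; apply: (le_bigmax _ (fun ij => `|x ij.1 ij.2|) (0, j)).
by rewrite leNgt (le_lt_trans xM).
Qed.

Lemma Rintegral_supp (D : set 'rV[R]_n) (f : 'rV[R]_n -> R) : (forall x, ~ D x -> f x = 0) ->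
  (\int[lebesgue_rV R n]_(x in D) f x = \int[lebesgue_rV R n]_x f x)%R.
Proof.
move=> f0; rewrite Rintegral_mkcond; congr Rintegral; apply/funext => x.
by rewrite /patch; case: ifPn => // /negP xD; rewrite f0// => Dx; apply: xD; rewrite inE.
Qed.

(** Both integrands vanish off the compact support of eta, so D may be replaced by R^n, where the
    divergence of [ext_d_codiff] integrates to zero. *)
Lemma int_by_parts (D : set 'rV[R]_n) k mu eta : smooth_form mu -> test_form D k eta ->
  L2dot D (ext_d mu) eta = L2dot D mu (codiff eta).
Proof.
move=> sm [keta se [K [cK KD e0]]].
have clK : closed K by apply: compact_closed => //; exact: norm_hausdorff.
have c0 x : ~ K x -> codiff eta x = 0 by exact: codiff_supp.
have [M HM] := compact_supp_in cK.
have cdot0l (u : covector R n) : cdot u 0 = 0.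
  by rewrite /cdot big1// => S _; rewrite ffunE mulr0.
have K1 x : ~ K x -> cdot (ext_d mu x) (eta x) = 0 by move=> Kx; rewrite e0.
have K2 x : ~ K x -> cdot (mu x) (codiff eta x) = 0 by move=> Kx; rewrite c0.
rewrite /L2dot (@Rintegral_supp D (fun x => cdot (ext_d mu x) (eta x))); last first.
  by move=> x Dx; apply: K1 => /KD.
rewrite (@Rintegral_supp D (fun x => cdot (mu x) (codiff eta x))); last first.
  by move=> x Dx; apply: K2 => /KD.
have s1 : smooth (fun x => cdot (ext_d mu x) (eta x)).
  by apply: smooth_cdot => //; exact: smooth_ext_d.
have s2 : smooth (fun x => cdot (mu x) (codiff eta x)).
  by apply: smooth_cdot => //; exact: smooth_codiff.
have i1 := supp_integrable (smooth_continuous s1) (HM _ K1).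
have i2 := supp_integrable (smooth_continuous s2) (HM _ K2).
apply/eqP; rewrite -subr_eq0 -RintegralB//.
pose G i y := \sum_(S : {set 'I_n} | i \in S) sgn R i S * (mu y (S :\ i) * eta y S).
have sG i : smooth (G i).
  apply: smooth_sum => S iS; apply: (@smoothM _ _ (cst (sgn R i S))); first exact: smooth_cst.
  by apply: (@smoothM _ _ (fun y => mu y (S :\ i)) (fun y => eta y S)); [exact: sm|exact: se].
have GM i : supp_in M (G i).
  by apply: HM => x Kx; rewrite /G big1// => S iS; rewrite e0// ffunE !mulr0.
have iG i : (lebesgue_rV R n).-integrable setT (fun x => (partial i (G i) x)%:E).
  apply: (@supp_integrable _ _ M); last exact: partial_supp.
  exact/smooth_continuous/smooth_partial.
rewrite (@eq_Rintegral _ _ _ _ _ (fun x => \sum_i partial i (G i) x)); last first.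
  move=> x _; apply: ext_d_codiff => S; exact: smooth_differentiable.
apply/eqP; rewrite /Rintegral; under eq_integral do rewrite -sumEFin.
rewrite integral_sum//= big1// => i _.
apply: (@integral_partial0 _ _ _ _ M) => //.
- exact: smooth_continuous.
- exact/smooth_continuous/smooth_partial.
- by move=> x; apply: diff_derivable; exact: smooth_differentiable.
Qed.

End form_calculus.

(** * Square integrable functions *)

Section L2.
Context d (T : measurableType d) (R : realType) (mu : {measure set T -> \bar R}).
Context (D : set T) (mD : measurable D).
Implicit Types f g h : T -> R.

Definition l2 f := measurable_fun D f /\ mu.-integrable D (fun x => (f x ^+ 2)%:E).

(** Estimates are made on squares, with (a + b)^2 <= 2 a^2 + 2 b^2 in place of the triangle
    inequality; squares also add up over cells. *)
Definition nsq f : R := (\int[mu]_(x in D) (f x ^+ 2))%R.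

Lemma integrableZl_EFin (r : R) f : mu.-integrable D (fun x => (f x)%:E) ->
  mu.-integrable D (fun x => (r * f x)%:E).
Proof. by move=> fi; under eq_fun do rewrite EFinM; exact: integrableZl. Qed.

Lemma l2_mul_integrable f g : l2 f -> l2 g -> mu.-integrable D (EFin \o (fun x => f x * g x)).
Proof.
move=> [mf fi] [mg gi].
apply: (@le_integrable _ _ _ mu D mD _ (fun x => (f x ^+ 2 + g x ^+ 2)%:E)).
- by apply/measurable_EFinP; exact: measurable_funM.
- move=> x Dx; rewrite /= lee_fin normrM.
  rewrite (@ger0_norm _ (f x ^+ 2 + g x ^+ 2)) ?addr_ge0 ?sqr_ge0//.
  rewrite -[f x ^+ 2]real_normK ?num_real// -[g x ^+ 2]real_normK ?num_real//.
  by have := sqr_ge0 (`|f x| - `|g x|); nra.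
- exact: integrableD fi gi.
Qed.

Lemma l2_le f g h : measurable_fun D h -> l2 f -> l2 g ->
  (forall x, D x -> h x ^+ 2 <= 2 * f x ^+ 2 + 2 * g x ^+ 2) -> l2 h.
Proof.
move=> mh [mf fi] [mg gi] hfg; split => //.
apply: (@le_integrable _ _ _ mu D mD _ (fun x => (2 * f x ^+ 2 + 2 * g x ^+ 2)%:E)).
- by apply/measurable_EFinP; exact: measurable_funX.
- move=> x Dx; rewrite /= lee_fin !ger0_norm ?sqr_ge0 ?hfg//.
  by have := sqr_ge0 (f x); have := sqr_ge0 (g x); lra.
- have h1 : mu.-integrable D (fun x => (2 * f x ^+ 2)%:E).
    exact: integrableZl_EFin.
  have h2 : mu.-integrable D (fun x => (2 * g x ^+ 2)%:E).
    exact: integrableZl_EFin.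
  exact: integrableD h1 h2.
Qed.

Lemma l2D f g : l2 f -> l2 g -> l2 (f \+ g).
Proof.
move=> lf lg; apply: (l2_le _ lf lg) => [|x Dx /=].
  by apply: measurable_funD; [exact: lf.1|exact: lg.1].
by have := sqr_ge0 (f x - g x); nra.
Qed.

Lemma l2B f g : l2 f -> l2 g -> l2 (f \- g).
Proof.
move=> lf lg; apply: (l2_le _ lf lg) => [|x Dx /=].
  by apply: measurable_funB; [exact: lf.1|exact: lg.1].
by have := sqr_ge0 (f x + g x); nra.
Qed.

Lemma l2_bmul (M : R) f g : measurable_fun D g -> (forall x, D x -> `|g x| <= M) -> l2 f ->
  l2 (fun x => g x * f x).
Proof.
move=> mg gM [mf fi]; split; first exact: measurable_funM.
apply: (@le_integrable _ _ _ mu D mD _ (fun x => (M ^+ 2 * f x ^+ 2)%:E)).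
- by apply/measurable_EFinP; apply: measurable_funX; exact: measurable_funM.
- move=> x Dx; rewrite /= lee_fin exprMn !(ger0_norm (mulr_ge0 (sqr_ge0 _) (sqr_ge0 _))).
  rewrite ler_wpM2r ?sqr_ge0// -[g x ^+ 2]real_normK ?num_real//.
  by rewrite lerXn2r ?nnegrE ?gM// (le_trans _ (gM x Dx)).
- exact: integrableZl_EFin.
Qed.

Lemma l2Z (r : R) f : l2 f -> l2 (fun x => r * f x).
Proof. by move=> lf; apply: (l2_bmul (M := `|r|)) lf => //. Qed.

Lemma l2_0 : l2 (fun=> 0).
Proof.
split => //; apply: (eq_integrable _ (fun=> 0%E)) => //; last exact: integrable0.
by move=> x _; rewrite expr0n.
Qed.

Lemma l2_sum (I : Type) (r : seq I) (P : pred I) (f : I -> T -> R) :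
  (forall i, P i -> l2 (f i)) -> l2 (fun x => \sum_(i <- r | P i) f i x).
Proof.
move=> lf; elim: r => [|i r IHr].
  by under eq_fun do rewrite big_nil; exact: l2_0.
case Pi: (P i); under eq_fun do rewrite big_cons Pi; last exact: IHr.
exact: l2D (lf _ Pi) IHr.
Qed.

Lemma nsq_ge0 f : 0 <= nsq f.
Proof. by apply: Rintegral_ge0 => x _; exact: sqr_ge0. Qed.

Lemma nsq0 : nsq (fun=> 0) = 0.
Proof.
by rewrite /nsq; under eq_Rintegral do rewrite expr0n/=; rewrite Rintegral_cst// mul0r.
Qed.

Lemma nsq_le f g h : l2 f -> l2 g -> l2 h ->
  (forall x, D x -> h x ^+ 2 <= 2 * f x ^+ 2 + 2 * g x ^+ 2) ->
  nsq h <= 2 * nsq f + 2 * nsq g.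
Proof.
move=> [mf fi] [mg gi] [mh hi] hfg; rewrite /nsq -!RintegralZl//.
have h1 : mu.-integrable D (fun x => (2 * f x ^+ 2)%:E).
  exact: integrableZl_EFin.
have h2 : mu.-integrable D (fun x => (2 * g x ^+ 2)%:E).
  exact: integrableZl_EFin.
rewrite -RintegralD//; apply: le_Rintegral => //.
exact: integrableD h1 h2.
Qed.

Lemma nsqD f g : l2 f -> l2 g -> nsq (f \+ g) <= 2 * nsq f + 2 * nsq g.
Proof.
move=> lf lg; apply: nsq_le => //; first exact: l2D.
by move=> x _ /=; have := sqr_ge0 (f x - g x); nra.
Qed.

Lemma nsqB f g : l2 f -> l2 g -> nsq (f \- g) <= 2 * nsq f + 2 * nsq g.
Proof.
move=> lf lg; apply: nsq_le => //; first exact: l2B.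
by move=> x _ /=; have := sqr_ge0 (f x + g x); nra.
Qed.

Lemma nsq_bmul (M : R) f g : measurable_fun D g -> (forall x, D x -> `|g x| <= M) -> l2 f ->
  nsq (fun x => g x * f x) <= M ^+ 2 * nsq f.
Proof.
move=> mg gM lf; have lgf := l2_bmul mg gM lf.
rewrite /nsq -RintegralZl//; last exact: lf.2.
apply: le_Rintegral => //; first exact: lgf.2.
  exact: integrableZl_EFin lf.2.
move=> x Dx; rewrite exprMn ler_wpM2r ?sqr_ge0// -[g x ^+ 2]real_normK ?num_real//.
by rewrite lerXn2r ?nnegrE ?gM// (le_trans _ (gM x Dx)).
Qed.

(** Each use of [nsqD] doubles the constant; all that matters is that it depends only on the number
    of terms. *)
Lemma nsq_sum (I : Type) (r : seq I) (P : pred I) (f : I -> T -> R) :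
  (forall i, P i -> l2 (f i)) ->
  nsq (fun x => \sum_(i <- r | P i) f i x) <= 2 ^+ size r * \sum_(i <- r | P i) nsq (f i).
Proof.
move=> lf; elim: r => [|i r IHr].
  by under [X in nsq X]eq_fun do rewrite big_nil; rewrite nsq0 big_nil mulr0.
have s0 : 0 <= \sum_(i <- r | P i) nsq (f i) by apply: sumr_ge0 => j _; exact: nsq_ge0.
have e1 : 1 <= 2 ^+ size r :> R by rewrite exprn_ege1// ler1n.
rewrite big_cons /= exprS; case Pi: (P i); last first.
  under [X in nsq X]eq_fun do rewrite big_cons Pi; apply: (le_trans IHr).
  by rewrite ler_wpM2r//; lra.
under [X in nsq X]eq_fun do rewrite big_cons Pi.
apply: (le_trans (nsqD (lf _ Pi) (l2_sum r lf))).
rewrite mulrDr lerD//; last by rewrite -mulrA ler_wpM2l.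
by rewrite ler_wpM2r ?nsq_ge0//; lra.
Qed.

Section finite.
Context (Dfin : (mu D < +oo)%E).
Notation m := (fine (mu D)).

Definition avg f : R := (\int[mu]_(x in D) f x)%R / m.

Lemma l2_bounded (M : R) f : measurable_fun D f -> (forall x, D x -> `|f x| <= M) -> l2 f.
Proof.
move=> mf fM; split => //; apply: measurable_bounded_integrable => //.
  exact: measurable_funX.
exists (M ^+ 2); split; first exact: num_real.
move=> N MN x Dx /=; rewrite ger0_norm ?sqr_ge0//; apply: le_trans (ltW MN).
rewrite -[f x ^+ 2]real_normK ?num_real//.
by rewrite lerXn2r ?nnegrE ?fM// (le_trans _ (fM x Dx)).
Qed.

Lemma l2_cst (r : R) : l2 (fun=> r).
Proof. exact: (l2_bounded (M := `|r|)). Qed.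

Lemma l2_integrable f : l2 f -> mu.-integrable D (EFin \o f).
Proof.
move=> lf; have := l2_mul_integrable lf (l2_cst 1).
by under [X in _.-integrable _ X]eq_fun do rewrite /= mulr1.
Qed.

Lemma int_avg f : m != 0 -> (\int[mu]_(x in D) f x)%R = m * avg f.
Proof. by move=> m0; rewrite /avg mulrC divfK. Qed.

Lemma avgD f g : l2 f -> l2 g -> avg (f \+ g) = avg f + avg g.
Proof. by move=> lf lg; rewrite /avg RintegralD ?mulrDl//; exact: l2_integrable. Qed.

Lemma avgB f g : l2 f -> l2 g -> avg (f \- g) = avg f - avg g.
Proof. by move=> lf lg; rewrite /avg RintegralB ?mulrBl//; exact: l2_integrable. Qed.

Lemma avgZ (r : R) f : l2 f -> avg (fun x => r * f x) = r * avg f.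
Proof. by move=> lf; rewrite /avg RintegralZl ?mulrA//; exact: l2_integrable. Qed.

Lemma avg_cst (r : R) : m != 0 -> avg (fun=> r) = r.
Proof. by move=> m0; rewrite /avg Rintegral_cst// mulfK. Qed.

Lemma avg_sum (I : Type) (r : seq I) (P : pred I) (f : I -> T -> R) :
  (forall i, P i -> l2 (f i)) ->
  avg (fun x => \sum_(i <- r | P i) f i x) = \sum_(i <- r | P i) avg (f i).
Proof.
move=> lf; elim: r => [|i r IHr].
  under [X in avg X]eq_fun do rewrite big_nil.
  by rewrite big_nil /avg Rintegral_cst// mul0r mul0r.
rewrite big_cons; case Pi: (P i); under [X in avg X]eq_fun do rewrite big_cons Pi.
  by rewrite -IHr -avgD//; [exact: lf|exact: l2_sum].
exact: IHr.
Qed.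

(** Expand the square: nsq (f - avg f) equals nsq f - m (avg f)^2 and is nonnegative. *)
Lemma nsq_avg f : l2 f -> nsq (fun=> avg f) <= nsq f.
Proof.
move=> lf; rewrite {1}/nsq Rintegral_cst//.
have [m0|m0] := eqVneq m 0; first by rewrite m0 mulr0 nsq_ge0.
have : 0 <= nsq (f \- (fun=> avg f)) by exact: nsq_ge0.
have -> : nsq (f \- (fun=> avg f)) = nsq f - 2 * avg f * (m * avg f) + avg f ^+ 2 * m.
  rewrite -int_avg// -[X in _ + X]Rintegral_cst// -RintegralZl//; last exact: l2_integrable.
  have i1 : mu.-integrable D (EFin \o (fun x => 2 * avg f * f x)).
    by apply: l2_integrable; exact: l2Z.
  rewrite /nsq -RintegralB//; last exact: lf.2.
  have i2 : mu.-integrable D (fun x => (f x ^+ 2 - 2 * avg f * f x)%:E).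
    exact: integrableB lf.2 i1.
  rewrite -RintegralD//; last exact: (l2_cst (avg f)).2.
  by apply: eq_Rintegral => x _ /=; ring.
by nra.
Qed.

End finite.
End L2.

(** * Weak exterior derivatives *)

Section forms_on.
Context (R : realType) (n : nat) (D : set 'rV[R]_n) (oD : open D) (M : R).
Context (DM : D `<=` cbox (const_mx (- M)%R) (const_mx M)).
Notation mu := (lebesgue_rV R n).
Implicit Types (u v w t e : dform R n) (a b c : covector R n) (S : {set 'I_n}).

Lemma measurable_open : measurable D.
Proof. exact: rV_open_measurable. Qed.
Notation mD := measurable_open.

Lemma open_fin : (mu D < +oo)%E.
Proof.
apply: le_lt_trans (cbox_fin n M); apply: le_measure => //; rewrite inE.
  exact: measurable_open.
exact: measurable_cbox.
Qed.

Definition l2form u := forall S, l2 mu D (fun x => u x S).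

Lemma smooth_l2 (f : 'rV[R]_n -> R) : smooth f -> l2 mu D f.
Proof.
move=> sf; have cf := smooth_continuous sf.
have [C HC] := continuous_bounded_cbox (const_mx (- M)) (const_mx M) cf.
apply: (l2_bounded mD open_fin (M := C)).
  by apply: measurable_funTS; exact: rV_continuous_measurable.
by move=> x Dx; apply: HC; exact: DM.
Qed.

Lemma smooth_l2form u : smooth_form u -> l2form u.
Proof. by move=> su S; exact: smooth_l2. Qed.

Lemma L2form_l2 k u : L2form D k u -> l2form u.
Proof. by move=> [_ h] S; have [] := h S. Qed.

Lemma l2formB u v : l2form u -> l2form v -> l2form (u \- v).
Proof.
move=> lu lv S; have -> : (fun x => (u \- v) x S) = (fun x => u x S) \- (fun x => v x S).
  by apply/funext => x; rewrite /= !ffunE.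
by apply: l2B => //; exact: mD.
Qed.

Lemma l2form_cst a : l2form (fun=> a).
Proof. by move=> S; exact: (l2_cst mD open_fin). Qed.

Lemma L2dot_sum u v : l2form u -> l2form v ->
  L2dot D u v = \sum_S (\int[mu]_(x in D) (u x S * v x S))%R.
Proof.
move=> lu lv; rewrite /L2dot /cdot /Rintegral.
under eq_integral do rewrite -sumEFin.
rewrite integral_sum//; last first.
- by move=> S; apply: l2_mul_integrable => //; exact: mD.
- exact: mD.
rewrite sum_fine// => S _; apply: integrable_fin_num; first exact: mD.
by apply: l2_mul_integrable => //; exact: mD.
Qed.

Lemma ae_Rintegral (f g : 'rV[R]_n -> R) : measurable_fun D f -> measurable_fun D g ->
  mu.-negligible [set x | D x /\ f x - g x != 0] ->
  (\int[mu]_(x in D) f x = \int[mu]_(x in D) g x)%R.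
Proof.
move=> mf mg fg; congr fine; apply: ae_eq_integral.
- exact: mD.
- exact/measurable_EFinP.
- exact/measurable_EFinP.
- apply: negligibleS fg => x /= /not_implyP[Dx h]; split => //.
  by apply/negP => /eqP /subr0_eq fg; apply: h; rewrite fg.
Qed.

Definition ae_form u v := forall S, mu.-negligible [set x | D x /\ u x S - v x S != 0].

Lemma ae_L2dot u v e : l2form u -> l2form v -> l2form e -> ae_form u v ->
  L2dot D u e = L2dot D v e.
Proof.
move=> lu lv le uv; rewrite !L2dot_sum//; apply: eq_bigr => S _.
apply: ae_Rintegral.
- by apply: measurable_funM; [exact: (lu S).1|exact: (le S).1].
- by apply: measurable_funM; [exact: (lv S).1|exact: (le S).1].
- apply: negligibleS (uv S) => x /= [Dx h]; split => //.
  by apply: contra h => /eqP /subr0_eq ->; rewrite subrr.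
Qed.

Lemma L2dotC u v : L2dot D u v = L2dot D v u.
Proof.
by apply: eq_Rintegral => x _; rewrite /cdot; apply: eq_bigr => S _; rewrite mulrC.
Qed.

Lemma ae_L2dot2 u v : l2form u -> l2form v -> ae_form u v -> L2dot D u u = L2dot D v v.
Proof.
by move=> lu lv uv; rewrite (ae_L2dot lu lv lu uv) L2dotC (ae_L2dot lu lv lv uv).
Qed.

Lemma L2dotBl u v e : l2form u -> l2form v -> l2form e ->
  L2dot D (u \- v) e = L2dot D u e - L2dot D v e.
Proof.
move=> lu lv le; rewrite !L2dot_sum//; last exact: l2formB.
rewrite -sumrB; apply: eq_bigr => S _; rewrite -RintegralB.
- by apply: eq_Rintegral => x _; rewrite /= !ffunE mulrBl.
- exact: mD.
- by apply: l2_mul_integrable => //; exact: mD.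
- by apply: l2_mul_integrable => //; exact: mD.
Qed.

Lemma L2formB k u v : L2form D k u -> L2form D k v -> L2form D k (u \- v).
Proof.
move=> Lu Lv; split.
  by move=> x S Sk; rewrite /= !ffunE Lu.1// Lv.1// subrr.
move=> S; have [] := l2formB (L2form_l2 Lu) (L2form_l2 Lv) S.
by [].
Qed.

(** Equality of the sets makes the representatives chosen by [d_on] equal, and not just almost
    everywhere. *)
Lemma weak_d_ext k w w' : (forall x, D x -> w x = w' x) -> weak_d D k w = weak_d D k w'.
Proof.
move=> ww'; apply/seteqP; split => t [Lt h]; split => // eta te; rewrite h//;
  by apply: eq_Rintegral => x; rewrite inE => Dx; rewrite ww'.
Qed.

Lemma test_form_l2 k eta : test_form D k eta -> l2form eta /\ l2form (codiff eta).
Proof.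
move=> [_ se _]; split; first exact: smooth_l2form.
by apply: smooth_l2form; exact: smooth_codiff.
Qed.

Lemma weak_dB k w w' t t' : l2form w -> l2form w' ->
  weak_d D k w t -> weak_d D k w' t' -> weak_d D k (w \- w') (t \- t').
Proof.
move=> lw lw' [Lt ht] [Lt' ht']; split; first exact: L2formB.
move=> eta te; have [le lce] := test_form_l2 te.
have lt := L2form_l2 Lt; have lt' := L2form_l2 Lt'.
by rewrite !L2dotBl// ht// ht'.
Qed.

Lemma cutoff_test_form k S (K : set 'rV[R]_n) (a b : 'rV[R]_n) (m : nat) : #|S| = k ->
  compact K -> K `<=` D -> obox a b `<=` K ->
  test_form D k (fun x => [ffun S' => if S' == S then cutoff a b m x else 0]).
Proof.
move=> Sk cK KD abK; split.
- by move=> x S' S'k; rewrite ffunE; case: eqP => // SS'; move: S'k; rewrite SS' Sk eqxx.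
- move=> S'; under eq_fun do rewrite ffunE; case: eqP => _; last exact: smooth_cst.
  exact: smooth_cutoff.
- exists K; split => // x Kx; apply/ffunP => S'; rewrite !ffunE.
  by case: eqP => // _; rewrite cutoff_eq0// => /abK.
Qed.

(** A cutoff times dx^S isolates the coefficient at S, to which [ae0_of_cutoff] applies. Off degree
    k + 1 both coefficients vanish. *)
Lemma weak_d_unique k w t t' : weak_d D k w t -> weak_d D k w t' -> ae_form t t'.
Proof.
move=> [Lt ht] [Lt' ht'] S.
have [Sk|Sk] := eqVneq #|S| k.+1; last first.
  apply: negligibleS (negligible_set0 _) => x /= [_].
  by rewrite Lt.1// Lt'.1// subrr eqxx.
have lt := L2form_l2 Lt; have lt' := L2form_l2 Lt'.
have lf : l2 mu D (fun x => t x S - t' x S).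
  exact: (l2B mD (f := fun x => t x S) (g := fun x => t' x S)).
apply: (ae0_of_cutoff oD); first exact: (l2_integrable mD open_fin lf).
move=> K a b m cK KD abK.
have te := cutoff_test_form m Sk cK KD abK; set eta := (fun x => _) in te.
have [le _] := test_form_l2 te.
have lc : l2 mu D (cutoff a b m) by apply: smooth_l2; exact: smooth_cutoff.
have fin := integrable_fin_num mD (l2_mul_integrable mD lf lc).
rewrite -[LHS]fineK//; congr EFin.
have := ht' _ te; rewrite -(ht _ te) => /eqP; rewrite eq_sym -subr_eq0 => /eqP.
rewrite -L2dotBl//.
move=> <-; rewrite /L2dot; apply: eq_Rintegral => x _.
rewrite /cdot (bigD1 S)//= big1 ?addr0 => [|S' S'S].
  by rewrite !ffunE eqxx.
by rewrite [eta x S']ffunE (negbTE S'S) mulr0.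
Qed.

Lemma P1m_L2form k p : P1m k p -> L2form D k p /\ smooth_form p.
Proof.
move=> [a [b [ka kb ->]]]; have s := smooth_P1m a b; split => //; split.
  by move=> x; apply: kcovectorD => //; exact: kcovector_koszul.
by move=> S; have [] := smooth_l2 (s S).
Qed.

Lemma cst_L2form k a : kcovector k a -> L2form D k (fun=> a).
Proof. by move=> ka; split => // S; have [] := l2form_cst a S. Qed.

Lemma weak_d_P1m k a b : kcovector k a -> kcovector k.+1 b ->
  weak_d D k (fun y => a + koszul y b) (fun=> k.+1%:R *: b).
Proof.
move=> ka kb; split; first by apply: cst_L2form; exact: kcovectorZ.
by move=> eta te; rewrite -(ext_d_P1m a kb) (int_by_parts (smooth_P1m a b) te).
Qed.

Lemma d_onP k w t : weak_d D k w t -> weak_d D k w (d_on D k w) /\ ae_form (d_on D k w) t.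
Proof.
move=> wt; have h : weak_d D k w (d_on D k w) by apply: xgetPex; exists t.
by split => //; exact: weak_d_unique wt.
Qed.

End forms_on.

(** * The local interpolator in closed form *)

Section cdot_theory.
Context (R : realType) (n : nat).
Implicit Types a b c : covector R n.

Lemma cdotDl a b c : cdot (a + b) c = cdot a c + cdot b c.
Proof. by rewrite /cdot -big_split/=; apply: eq_bigr => S _; rewrite ffunE mulrDl. Qed.

Lemma cdotC a b : cdot a b = cdot b a.
Proof. by apply: eq_bigr => S _; rewrite mulrC. Qed.

Lemma cdotDr a b c : cdot c (a + b) = cdot c a + cdot c b.
Proof. by rewrite cdotC cdotDl !(cdotC c). Qed.

Lemma cdotZl (r : R) a b : cdot (r *: a) b = r * cdot a b.
Proof. by rewrite /cdot mulr_sumr; apply: eq_bigr => S _; rewrite covectorZE mulrA. Qed.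

Lemma cdotZr (r : R) a b : cdot a (r *: b) = r * cdot a b.
Proof. by rewrite cdotC cdotZl cdotC. Qed.

Lemma cdotBl a b c : cdot (a - b) c = cdot a c - cdot b c.
Proof. by rewrite -scaleN1r cdotDl cdotZl mulN1r. Qed.

Lemma cdot0r a : cdot a 0 = 0.
Proof. by rewrite /cdot big1// => S _; rewrite ffunE mulr0. Qed.

Lemma cdot_eq0 a : cdot a a = 0 -> a = 0.
Proof.
move=> h; apply/ffunP => S; rewrite ffunE; apply/eqP; rewrite -sqrf_eq0 expr2.
have := @psumr_eq0P R _ xpredT (fun S => a S * a S).
by move=> /(_ (fun S _ => sqr_ge0 _) h S isT) ->.
Qed.

End cdot_theory.

Section local_interpolator.
Context (R : realType) (n : nat) (D : set 'rV[R]_n) (oD : open D) (M : R).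
Context (DM : D `<=` cbox (const_mx (- M)%R) (const_mx M)).
Notation mu := (lebesgue_rV R n).
Notation m := (fine (mu D)).
Notation mD := (measurable_open oD).
Notation Dfin := (open_fin oD DM).
Notation l2form := (l2form D).
Implicit Types (u v w t : dform R n) (a b c e : covector R n) (S : {set 'I_n}).

Definition centroid : 'rV[R]_n := \row_i avg mu D (fun x => x 0 i).
Notation x0 := centroid.

Definition vavg u : covector R n := [ffun S : {set 'I_n} => avg mu D (fun x => u x S)].

Definition contract u : dform R n := fun x => koszul (x - x0) (u x).

Lemma l2_coord i : l2 mu D (fun x => x 0 i).
Proof. by apply: (smooth_l2 oD DM); exact: smooth_coord. Qed.

Lemma coord_bound (x : 'rV[R]_n) i : D x -> `|x 0 i| <= `|M|.
Proof.
move=> /DM /(_ i); rewrite !mxE => /andP[h1 h2].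
by rewrite ler_norml; have := ler_norm M; lra.
Qed.

Lemma avg_bound (f : 'rV[R]_n -> R) (C : R) : 0 <= C -> l2 mu D f ->
  (forall x, D x -> `|f x| <= C) -> `|avg mu D f| <= C.
Proof.
move=> C0 lf fC; have fi := l2_integrable mD Dfin lf.
have [m0|m0] := eqVneq m 0; first by rewrite /avg m0 invr0 mulr0 normr0.
have mgt0 : 0 < m by rewrite lt_def m0 fine_ge0.
rewrite /avg normrM normfV (ger0_norm (ltW mgt0)) ler_pdivrMr//.
apply: (le_trans (le_normr_Rintegral mD fi)).
rewrite -Rintegral_cst; last exact: mD.
apply: le_Rintegral => //; first exact: mD.
- have := integrable_abse fi; by [].
- by apply: (l2_integrable mD Dfin); exact: (l2_cst mD Dfin).
Qed.

(** The centroid obeys the bound |M| of the points it averages. *)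
Lemma centroid_bound (x : 'rV[R]_n) i : D x -> `|(x - x0) 0 i| <= 2 * `|M|.
Proof.
move=> Dx; rewrite !mxE; apply: (le_trans (ler_normB _ _)).
have := coord_bound i Dx.
have := avg_bound (normr_ge0 M) (l2_coord i) (fun x Dx => coord_bound i Dx).
by lra.
Qed.

Lemma contractE u x S : contract u x S =
  \sum_(i | i \notin S) (sgn R i S * (x - x0) 0 i) * u x (i |: S).
Proof. by rewrite /contract ffunE. Qed.

Lemma contract_factor_bound i S x : D x -> `|sgn R i S * (x - x0) 0 i| <= 2 * `|M|.
Proof. by move=> Dx; rewrite normrM normrX normrN1 expr1n mul1r; exact: centroid_bound. Qed.

Lemma measurable_contract_factor i S :
  measurable_fun D (fun x : 'rV[R]_n => sgn R i S * (x - x0) 0 i).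
Proof.
apply: measurable_funM => //; under eq_fun do rewrite !mxE.
by apply: measurable_funB => //; exact: (l2_coord i).1.
Qed.

Lemma l2form_contract u : l2form u -> l2form (contract u).
Proof.
move=> lu S; under eq_fun do rewrite contractE.
apply: l2_sum; first exact: mD.
move=> i _; apply: (l2_bmul mD (M := 2 * `|M|)) => //.
  exact: measurable_contract_factor.
by move=> x Dx; exact: contract_factor_bound.
Qed.

Lemma cdot_integrable u v : l2form u -> l2form v ->
  mu.-integrable D (fun x => (cdot (u x) (v x))%:E).
Proof.
move=> lu lv; under eq_fun do rewrite /cdot -sumEFin.
apply: integrable_sum; first exact: mD.
by move=> S _; apply: l2_mul_integrable => //; exact: mD.
Qed.

Lemma vavgB u v : l2form u -> l2form v -> vavg (u \- v) = vavg u - vavg v.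
Proof.
move=> lu lv; apply/ffunP => S; rewrite !ffunE -(avgB mD Dfin (lu S) (lv S)).
by congr avg; apply/funext => x; rewrite /= !ffunE.
Qed.

Lemma kcovector_vavg k u : kform k u -> kcovector k (vavg u).
Proof.
move=> ku S Sk; rewrite ffunE /avg.
rewrite (@eq_Rintegral _ _ _ _ _ (fun=> 0)); last by move=> x _; rewrite ku.
by rewrite Rintegral_cst ?mul0r//; exact: mD.
Qed.

Lemma kform_contract k u : kform k.+1 u -> kform k (contract u).
Proof. by move=> ku x; apply: kcovector_koszul; exact: ku. Qed.


Lemma vavg_cst a : m != 0 -> vavg (fun=> a) = a.
Proof. by move=> m0; apply/ffunP => S; rewrite ffunE (avg_cst mD). Qed.

(** The coefficients are combinations of coordinates of x - x0, which have mean zero. This removes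
    all cross terms between a and b. *)
Lemma vavg_contract_cst b : m != 0 -> vavg (contract (fun=> b)) = 0.
Proof.
move=> m0; apply/ffunP => S; rewrite !ffunE.
under [X in avg _ _ X]eq_fun do rewrite contractE.
have lx i : l2 mu D (fun x : 'rV[R]_n => x 0 i - x0 0 i).
  exact: (l2B mD (l2_coord i) (l2_cst mD Dfin (x0 0 i))).
rewrite (avg_sum mD Dfin) => [|i _]; last first.
  have := l2Z mD (sgn R i S * b (i |: S)) (lx i).
  by congr l2; apply/funext => x; rewrite !mxE; ring.
rewrite big1// => i _.
have -> : (fun x : 'rV[R]_n => sgn R i S * (x - x0) 0 i * b (i |: S)) =
    (fun x => (sgn R i S * b (i |: S)) * (x 0 i - x0 0 i)).
  by apply/funext => x; rewrite !mxE; ring.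
rewrite (avgZ mD Dfin _ (lx i)) (avgB mD Dfin (l2_coord i) (l2_cst mD Dfin (x0 0 i))).
by rewrite (avg_cst mD _ m0) mxE subrr mulr0.
Qed.

Lemma L2dot_cst u e : m != 0 -> l2form u -> L2dot D u (fun=> e) = m * cdot (vavg u) e.
Proof.
move=> m0 lu; rewrite (L2dot_sum oD lu (l2form_cst oD DM e)) /cdot mulr_sumr.
apply: eq_bigr => S _; rewrite ffunE mulrA -(int_avg _ m0) -RintegralZr//.
  exact: mD.
exact: (l2_integrable mD Dfin (lu S)).
Qed.

(** [cdot_eps] moves the linear factor from the test form onto u. *)
Lemma L2dot_eps u c e : m != 0 -> l2form u ->
  L2dot D u (fun x => c + eps (x - x0) e) =
  m * (cdot (vavg u) c + cdot (vavg (contract u)) e).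
Proof.
move=> m0 lu; have lcu := l2form_contract lu.
rewrite mulrDr -!L2dot_cst// /L2dot -RintegralD.
- by apply: eq_Rintegral => x _; rewrite cdotDr [X in _ + X]cdotC cdot_eps [X in _ + X]cdotC.
- exact: mD.
- exact: cdot_integrable lu (l2form_cst oD DM c).
- exact: cdot_integrable lcu (l2form_cst oD DM e).
Qed.


(* Closed form of the interpolator.  For k = n the weak derivative [t] vanishes
   and the factor (n - k)^-1 is the junk value 0^-1 = 0. *)
Definition local_interp k w t : dform R n := fun x =>
  (vavg w + (n - k)%:R^-1 *: vavg (contract t)) + koszul (x - x0) (k.+1%:R^-1 *: vavg t).

(** Moving the origin of the Koszul operator only changes the constant part, by [koszul x0 b]. *)
Lemma P1m_centered k a b : kcovector k a -> kcovector k.+1 b ->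
  P1m k (fun x => a + koszul (x - x0) b).
Proof.
move=> ka kb; exists (a - koszul x0 b), b; split => //.
  by rewrite -scaleN1r; apply: kcovectorD => //; apply/kcovectorZ/kcovector_koszul.
by apply/funext => x; rewrite koszulBl addrA addrAC.
Qed.

Lemma P1m_centeredP k p : P1m k p ->
  exists a b, [/\ kcovector k a, kcovector k.+1 b & p = fun x => a + koszul (x - x0) b].
Proof.
move=> [a [b [ka kb ->]]]; exists (a + koszul x0 b), b; split => //.
  by apply: kcovectorD => //; exact: kcovector_koszul.
by apply/funext => x; rewrite koszulBl addrA addrAC addrK.
Qed.

Lemma weak_d_centered k a b : kcovector k a -> kcovector k.+1 b ->
  weak_d D k (fun x => a + koszul (x - x0) b) (fun=> k.+1%:R *: b).
Proof.
move=> ka kb.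
have -> : (fun x : 'rV[R]_n => a + koszul (x - x0) b) =
    (fun x => (a - koszul x0 b) + koszul x b).
  by apply/funext => x; rewrite koszulBl addrA addrAC.
apply: (weak_d_P1m oD DM) => //.
by rewrite -scaleN1r; apply: kcovectorD => //; apply/kcovectorZ/kcovector_koszul.
Qed.

Lemma l2form_centered k a b : kcovector k a -> kcovector k.+1 b ->
  l2form (fun x => a + koszul (x - x0) b).
Proof.
move=> ka kb; have [_ s] := P1m_L2form oD DM (P1m_centered ka kb).
exact: (smooth_l2form oD DM).
Qed.

Lemma vavg_centered k a b : m != 0 -> kcovector k a -> kcovector k.+1 b ->
  vavg (fun x => a + koszul (x - x0) b) = a.
Proof.
move=> m0 ka kb.
have -> : (fun x : 'rV[R]_n => a + koszul (x - x0) b) = (fun=> a) \- (contract (fun=> - b)).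
  by apply/funext => x; rewrite /contract/= -[- b]scaleN1r koszulZ scaleN1r opprK.
have lc : l2form (contract (fun=> - b)).
  by apply: l2form_contract; exact: (l2form_cst oD DM).
by rewrite (vavgB (l2form_cst oD DM a) lc) vavg_cst// vavg_contract_cst// subr0.
Qed.

(* The bilinear form defining the interpolator, on the test forms
   [c + eps (x - centroid) e] of P1sm, whose codifferential is [- (n - k) e].
   Linear functions centred at the centroid have mean zero, which decouples
   [c] from [e]. *)
Definition interp_functional k w t c e : R :=
  L2dot D w (fun=> - (n - k)%:R *: e) - L2dot D t (fun x => c + eps (x - x0) e).

Lemma interp_functionalE k w t c e : m != 0 -> l2form w -> l2form t ->
  interp_functional k w t c e =
  - (m * (cdot ((n - k)%:R *: vavg w + vavg (contract t)) e + cdot (vavg t) c)).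
Proof.
move=> m0 lw lt; rewrite /interp_functional L2dot_cst// L2dot_eps//.
by rewrite cdotDl cdotZl cdotZr; ring.
Qed.

Lemma codiff_centered k c e : kcovector k e ->
  codiff (fun x => c + eps (x - x0) e) = fun=> - (n - k)%:R *: e.
Proof.
move=> ke.
have -> : (fun x : 'rV[R]_n => c + eps (x - x0) e) = (fun x => (c - eps x0 e) + eps x e).
  by apply/funext => x; rewrite epsBl addrA addrAC.
exact: codiff_P1sm.
Qed.

(** Two replacements in the defining equations: test forms are centred at x0, and the chosen
    derivative of the polynomial gives way to the classical one, equal almost everywhere. *)
Lemma is_interpP k w mu' : (k < n)%N -> l2form w -> l2form (d_on D k w) ->
  is_interp D k w mu' <-> exists a b, [/\ kcovector k a, kcovector k.+1 b,
    mu' = (fun x => a + koszul (x - x0) b) &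
    forall c e, kcovector k.+1 c -> kcovector k e ->
      interp_functional k (fun x => a + koszul (x - x0) b) (fun=> k.+1%:R *: b) c e =
      interp_functional k w (d_on D k w) c e].
Proof.
move=> kn lw lt.
have key a b c e : kcovector k a -> kcovector k.+1 b -> kcovector k e ->
    L2dot D (d_on D k (fun x => a + koszul (x - x0) b)) (fun x => c + eps (x - x0) e) =
    L2dot D (fun=> k.+1%:R *: b) (fun x => c + eps (x - x0) e).
  move=> ka kb ke; have wd := weak_d_centered ka kb.
  have [wd' ae] := d_onP oD DM wd.
  apply: (ae_L2dot oD) => //.
  - exact: (L2form_l2 wd'.1).
  - exact: (l2form_cst oD DM).
  - apply: (smooth_l2form oD DM) => S.
    have -> : (fun x : 'rV[R]_n => (c + eps (x - x0) e) S) = (fun x => (c - eps x0 e) S +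
        \sum_(j | j \in S) (sgn R j S * e (S :\ j)) * x 0 j).
      by apply/funext => x; rewrite -P1sm_coefE epsBl addrA addrAC.
    exact: smooth_affine.
split.
  move=> [/P1m_centeredP[a [b [ka kb ->]]] h]; exists a, b; split => // c e kc ke.
  have /h : P1sm k.+1 (fun x => c + eps (x - x0) e).
    apply/(P1smP _ kn); exists (c - eps x0 e), e; split => //.
      by rewrite -scaleN1r; apply: kcovectorD => //; apply/kcovectorZ/kcovector_eps.
    by apply/funext => x; rewrite epsBl addrA addrAC.
  by rewrite (codiff_centered c ke) key.
move=> [a [b [ka kb -> h]]]; split; first exact: P1m_centered.
move=> _ /(P1smP _ kn)[c [e [kc ke ->]]].
have E : (fun x : 'rV[R]_n => c + eps x e) = (fun x => (c + eps x0 e) + eps (x - x0) e).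
  by apply/funext => x; rewrite epsBl addrA addrAC addrK.
rewrite E (codiff_centered _ ke) key//; apply: h => //.
by apply: kcovectorD => //; exact: kcovector_eps.
Qed.

Lemma weak_d_top k w t : (n <= k)%N -> weak_d D k w t -> t = fun=> 0.
Proof.
move=> nk [[kt _] _]; apply/funext => x; apply/ffunP => S; rewrite ffunE kt//.
by rewrite neq_ltn ltnS (leq_trans (max_card _))// card_ord.
Qed.

(** The closed form solves the equations, and any solution equals it; hence so does the one picked
    by [xget]. *)
Lemma interpE k w : m != 0 -> (k <= n)%N -> Hform D k w ->
  interp D k w = local_interp k w (d_on D k w).
Proof.
move=> m0 kn [Lw [t0 wt0]]; have lw := L2form_l2 Lw.
have [wt _] := d_onP oD DM wt0; have lt := L2form_l2 wt.1.
set t := d_on D k w in wt lt *.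
have kcw := kcovector_vavg Lw.1; have kct := kcovector_vavg wt.1.1.
have kcc := kcovector_vavg (kform_contract wt.1.1).
have ka : kcovector k (vavg w + (n - k)%:R^-1 *: vavg (contract t)).
  by apply: kcovectorD => //; exact: kcovectorZ.
have kb : kcovector k.+1 (k.+1%:R^-1 *: vavg t) by exact: kcovectorZ.
rewrite /interp; case: ifPn => [kltn|].
  have lcst b : l2form (fun=> b) := l2form_cst oD DM b.
  have funcE a b c e : kcovector k a -> kcovector k.+1 b ->
      interp_functional k (fun x => a + koszul (x - x0) b) (fun=> k.+1%:R *: b) c e =
      - (m * (cdot ((n - k)%:R *: a) e + cdot (k.+1%:R *: b) c)).
    move=> ka' kb'; rewrite interp_functionalE//; last exact: l2form_centered kb'.
    by rewrite (vavg_centered m0 ka' kb') vavg_contract_cst// addr0 vavg_cst.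
  have nk0 : (n - k)%:R != 0 :> R by rewrite pnatr_eq0 subn_eq0 -ltnNge.
  have ex : is_interp D k w (local_interp k w t).
    apply/is_interpP => //; exists (vavg w + (n - k)%:R^-1 *: vavg (contract t)),
      (k.+1%:R^-1 *: vavg t); split => // c e kc ke.
    rewrite funcE// interp_functionalE// scalerDr !scalerA !divff// ?scale1r//.
  have := @xgetPex _ (fun=> 0) _ (ex_intro _ _ ex).
  move=> /(is_interpP _ kltn lw lt)[a [b [ka' kb' -> h]]].
  have {}h c e : kcovector k.+1 c -> kcovector k e ->
      cdot ((n - k)%:R *: a) e + cdot (k.+1%:R *: b) c =
      cdot ((n - k)%:R *: vavg w + vavg (contract t)) e + cdot (vavg t) c.
    move=> kc ke; have := h _ _ kc ke; rewrite funcE// interp_functionalE//.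
    by move=> /oppr_inj /(mulfI m0).
  have kc0 j : kcovector j (0 : covector R n) by move=> S _; rewrite ffunE.
  (* Test with e = 0 and c the defect itself; a is treated the same way with c = 0. *)
  have eb : k.+1%:R *: b = vavg t.
    apply/eqP; rewrite -subr_eq0; apply/eqP/cdot_eq0.
    have kz : kcovector k.+1 (k.+1%:R *: b - vavg t).
      by rewrite -[- _]scaleN1r; apply: kcovectorD; exact: kcovectorZ.
    have := h _ 0 kz (kc0 k); rewrite !cdot0r !add0r => /eqP.
    by rewrite -subr_eq0 -cdotBl => /eqP.
  have ea : (n - k)%:R *: a = (n - k)%:R *: vavg w + vavg (contract t).
    apply/eqP; rewrite -subr_eq0; apply/eqP/cdot_eq0.
    have kz : kcovector k ((n - k)%:R *: a - ((n - k)%:R *: vavg w + vavg (contract t))).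
      rewrite -[- _]scaleN1r; apply: kcovectorD; apply: kcovectorZ => //.
      by apply: kcovectorD => //; exact: kcovectorZ.
    have := h 0 _ (kc0 k.+1) kz; rewrite !cdot0r !addr0 => /eqP.
    by rewrite -subr_eq0 -cdotBl => /eqP.
  rewrite /local_interp -eb scalerA mulVf ?pnatr_eq0// scale1r.
  have -> : vavg (contract t) = (n - k)%:R *: a - (n - k)%:R *: vavg w.
    by rewrite ea addrAC subrr add0r.
  apply/funext => x; congr (_ + _).
  by rewrite scalerBr !scalerA mulVf// !scale1r addrCA subrr addr0.
(* For k = n the derivative vanishes and the closed form is the mean of w, the projection onto
   constants. *)
rewrite -leqNgt => nk; have tE : t = fun=> 0 by exact: weak_d_top wt.
have -> : local_interp k w t = fun=> vavg w.
  apply/funext => x; rewrite /local_interp tE vavg_contract_cst// vavg_cst//.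
  have k0 y : koszul y (0 : covector R n) = 0 by rewrite -{1}(scale0r 0) koszulZ scale0r.
  by rewrite !scaler0 addr0 k0 addr0.
have PL a : kcovector k a -> (forall eta, P0 k eta -> L2dot D (fun=> a) eta = L2dot D w eta) <->
    a = vavg w.
  move=> ka'; have lcst b : l2form (fun=> b) := l2form_cst oD DM b.
  split => [h|-> _ [e ke ->]]; last by rewrite !L2dot_cst// vavg_cst.
  have kz : kcovector k (a - vavg w).
    by rewrite -[- _]scaleN1r; apply: kcovectorD => //; exact: kcovectorZ.
  apply/eqP; rewrite -subr_eq0; apply/eqP/cdot_eq0.
  have := h _ (ex_intro2 _ _ _ kz erefl); rewrite !L2dot_cst// vavg_cst// => /(mulfI m0) /eqP.
  by rewrite -subr_eq0 -cdotBl => /eqP.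
have ex : is_L2proj_P0 D k w (fun=> vavg w).
  by split; [exists (vavg w)|apply/PL].
have := @xgetPex _ (fun=> 0) _ (ex_intro _ _ ex).
by move=> [[a ka' ->] h]; apply/funext => x; apply/PL.
Qed.

End local_interpolator.

(** * Local estimate *)

Section local_estimate.
Context (R : realType) (n : nat) (D : set 'rV[R]_n) (oD : open D) (M : R).
Context (DM : D `<=` cbox (const_mx (- M)%R) (const_mx M)).
Notation mu := (lebesgue_rV R n).
Notation m := (fine (mu D)).
Notation mD := (measurable_open oD).
Notation Dfin := (open_fin oD DM).
Notation l2form := (l2form D).
Notation x0 := (centroid D).
Implicit Types (u v w t p : dform R n) (a b c e : covector R n) (S : {set 'I_n}).

Definition formsq u : R := \sum_S nsq mu D (fun x => u x S).

Lemma formsq_ge0 u : 0 <= formsq u.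
Proof. by apply: sumr_ge0 => S _; exact: nsq_ge0. Qed.

Lemma L2dot_formsq u : l2form u -> L2dot D u u = formsq u.
Proof.
move=> lu; rewrite (L2dot_sum oD lu lu); apply: eq_bigr => S _.
by apply: eq_Rintegral => x _; rewrite expr2.
Qed.

Lemma formsqB u v : l2form u -> l2form v -> formsq (u \- v) <= 2 * formsq u + 2 * formsq v.
Proof.
move=> lu lv; rewrite /formsq !mulr_sumr -big_split/=; apply: ler_sum => S _.
apply: le_trans (nsqB mD (lu S) (lv S)).
by rewrite le_eqVlt; apply/orP; left; apply/eqP; congr nsq; apply/funext => x; rewrite /= !ffunE.
Qed.

Lemma formsq_cstZ (r : R) a : `|r| <= 1 -> formsq (fun=> r *: a) <= formsq (fun=> a).
Proof.
move=> r1; apply: ler_sum => S _.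
have := @nsq_bmul _ _ _ mu D mD 1 (fun=> a S) (fun=> r) _ (fun _ _ => r1) (l2_cst mD Dfin (a S)).
rewrite expr1n mul1r => h; apply: le_trans (h _) => //.
by rewrite le_eqVlt; apply/orP; left; apply/eqP; congr nsq; apply/funext => x; rewrite covectorZE.
Qed.

Lemma formsq_vavg u : l2form u -> formsq (fun=> vavg D u) <= formsq u.
Proof.
move=> lu; apply: ler_sum => S _; apply: le_trans (nsq_avg mD Dfin (lu S)).
by rewrite le_eqVlt; apply/orP; left; apply/eqP; congr nsq; apply/funext => x; rewrite ffunE.
Qed.

(** The factors come from the sum over the coefficients S, from [nsq_sum] over the n indices, from
    the number of those terms, and from [centroid_bound]. *)
Definition contract_bound (M : R) : R :=
  #|{set 'I_n}|%:R * (2 ^+ n * (n%:R * (2 * `|M|) ^+ 2)).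

Lemma contract_bound_ge0 : 0 <= contract_bound M.
Proof. by rewrite !mulr_ge0. Qed.

Lemma formsq_contract u : l2form u -> formsq (contract D u) <= contract_bound M * formsq u.
Proof.
move=> lu.
suff key S : nsq mu D (fun x => contract D u x S) <=
    2 ^+ n * (n%:R * (2 * `|M|) ^+ 2) * formsq u.
  apply: (le_trans (ler_sum _ (fun S _ => key S))).
  by rewrite sumr_const -[leLHS]mulr_natl /contract_bound !mulrA.
under [X in nsq _ _ X]eq_fun do rewrite contractE.
have lS i : l2 mu D (fun x : 'rV[R]_n => sgn R i S * (x - x0) 0 i * u x (i |: S)).
  apply: (l2_bmul mD (M := 2 * `|M|)) => //.
    exact: (measurable_contract_factor oD DM).
  by move=> x Dx; exact: (contract_factor_bound oD DM).
apply: (le_trans (nsq_sum mD _ (fun i _ => lS i))).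
have -> : size (index_enum 'I_n) = n by rewrite -[RHS](card_ord n) cardT enumT.
rewrite -mulrA ler_wpM2l ?exprn_ge0//.
apply: (@le_trans _ _ (\sum_(i : 'I_n) (2 * `|M|) ^+ 2 * formsq u)).
  rewrite big_mkcond; apply: ler_sum => i _.
  have F0 : 0 <= (2 * `|M|) ^+ 2 * formsq u by rewrite mulr_ge0 ?sqr_ge0 ?formsq_ge0.
  case: ifPn => // _.
  apply: (le_trans (@nsq_bmul _ _ _ mu D mD (2 * `|M|) (fun x => u x (i |: S)) _
     (measurable_contract_factor oD DM i S) (fun x Dx => contract_factor_bound oD DM i S Dx) (lu _))).
  rewrite ler_wpM2l ?sqr_ge0// /formsq (bigD1 (i |: S))//= lerDl.
  by apply: sumr_ge0 => S' _; exact: nsq_ge0.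
by rewrite sumr_const card_ord -[leLHS]mulr_natl mulrA.
Qed.

Definition local_constant (M : R) : R := 6 + 16 * contract_bound M.

(** True even if the equations had no solution, as the default form 0 lies in P1m. This covers null
    cells. *)
Lemma interp_P1m k w : P1m k (interp D k w).
Proof.
have kc0 j : kcovector j (0 : covector R n) by move=> S _; rewrite ffunE.
have k0 y : koszul y (0 : covector R n) = 0 by rewrite -{1}(scale0r 0) koszulZ scale0r.
rewrite /interp; set P := (if _ then _ else _).
have [h|h] := pselect (exists mu', P mu').
  have := @xgetPex _ (fun=> 0) _ h; rewrite /P; case: ifPn => _ [] //.
  move=> [a ka ->] _; exists a, 0; split => //.
  by apply/funext => x; rewrite k0 addr0.
rewrite xgetPN; first by exists 0, 0; split => //; apply/funext => x; rewrite k0 addr0.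
by move=> mu' Pmu'; apply: h; exists mu'.
Qed.

Lemma weak_d_sub_P1m k w t p : L2form D k w -> weak_d D k w t -> P1m k p ->
  exists t', weak_d D k (w \- p) t'.
Proof.
move=> Lw wt [a [b [ka kb ->]]]; eexists.
apply: (weak_dB oD DM _ _ wt (weak_d_P1m oD DM ka kb)); first exact: L2form_l2 Lw.
by apply: (smooth_l2form oD DM); exact: smooth_P1m.
Qed.

(** A and B stand for the squared norms of d(w - p) and w - p, k for [contract_bound M]. Three
    nested uses of [formsqB] give 6 B + 16 k A for the form and one gives 4 A for its derivative,
    whence 6 + 16 k. *)
Lemma interp_error_arith (k A B n1 n2 n3 n4 j1 j2 j3 r : R) :
  n1 <= 2 * B + 2 * n2 -> n2 <= 2 * j1 + 2 * n3 -> n3 <= 2 * j2 + 2 * j3 ->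
  n4 <= 2 * A + 2 * r -> r <= A -> j1 <= B -> j2 <= k * A -> j3 <= k * A ->
  0 <= A -> 0 <= B -> 0 <= k * B -> n4 + n1 <= (6 + 16 * k) * (A + B).
Proof.
move=> *; have -> : (6 + 16 * k) * (A + B) = 6 * A + 6 * B + 16 * (k * A) + 16 * (k * B) by ring.
lra.
Qed.

Lemma local_interp_estimate k w p I : m != 0 -> Hform D k w -> P1m k p ->
  I = local_interp D k w (d_on D k w) ->
  L2dot D (d_on D k (w \- I)) (d_on D k (w \- I)) + L2dot D (w \- I) (w \- I) <=
  local_constant M *
  (L2dot D (d_on D k (w \- p)) (d_on D k (w \- p)) + L2dot D (w \- p) (w \- p)).
Proof.
move=> m0 [Lw [t0 wt0]] Pp ->; have lw := L2form_l2 Lw.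
have [wt _] := d_onP oD DM wt0; have lt := L2form_l2 wt.1.
set t := d_on D k w in wt lt *; clear I; set I := local_interp D k w t.
have kcw := kcovector_vavg oD Lw.1; have kct := kcovector_vavg oD wt.1.1.
have kcc := kcovector_vavg oD (kform_contract D wt.1.1).
have [a [b [ka kb pE]]] := P1m_centeredP D Pp.
have lp : l2form p by rewrite pE; exact: (l2form_centered oD DM ka kb).
have lcst c : l2form (fun=> c) := l2form_cst oD DM c.
have kaI : kcovector k (vavg D w + (n - k)%:R^-1 *: vavg D (contract D t)).
  by apply: kcovectorD => //; exact: kcovectorZ.
have kbI : kcovector k.+1 (k.+1%:R^-1 *: vavg D t) by exact: kcovectorZ.
have k1 : k.+1%:R != 0 :> R by rewrite pnatr_eq0.
have dI := weak_d_centered oD DM kaI kbI; rewrite scalerA divff// scale1r in dI.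
have {}dI : weak_d D k I (fun=> vavg D t) := dI.
have lI : l2form I by exact: (l2form_centered oD DM kaI kbI).
have dp := weak_d_centered oD DM ka kb; rewrite -pE in dp.
have [wdI aeI] := d_onP oD DM (weak_dB oD DM lw lI wt dI).
have [wdp aep] := d_onP oD DM (weak_dB oD DM lw lp wt dp).
pose s := t \- (fun=> k.+1%:R *: b); pose v := w \- p.
have ls : l2form s by exact: l2formB.
have lv : l2form v by exact: l2formB.
have lcs : l2form (contract D s) by exact: (l2form_contract oD DM).
(* The chosen derivatives are exchanged for t - avg t and s, to which they are equal almost
   everywhere. *)
rewrite (ae_L2dot2 oD (L2form_l2 wdI.1) _ aeI); last exact: l2formB.
rewrite (ae_L2dot2 oD (L2form_l2 wdp.1) _ aep)//.
have sE : vavg D s = vavg D t - k.+1%:R *: b.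
  by rewrite (vavgB oD DM)// (vavg_cst oD).
have vE : vavg D v = vavg D w - a.
  by rewrite (vavgB oD DM)// pE (vavg_centered oD DM m0 ka kb).
have csE : vavg D (contract D s) = vavg D (contract D t).
  have -> : contract D s = contract D t \- contract D (fun=> k.+1%:R *: b).
    apply/funext => x; rewrite /contract/= /s/= -[- (_ *: b)]scaleN1r koszulD koszulZ.
    by rewrite scaleN1r.
  rewrite (vavgB oD DM) ?(vavg_contract_cst oD DM) ?subr0//.
    exact: (l2form_contract oD DM).
  exact: (l2form_contract oD DM).
have -> : t \- (fun=> vavg D t) = s \- (fun=> vavg D s).
  by apply/funext => x; rewrite /= sE /s /= opprB addrA subrK.
(* J1 - (J2 - J3) is [local_interp D k v s]. J2 carries a minus sign so that only differences occur
   and [formsqB] applies. *)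
pose J1 : dform R n := fun=> vavg D v.
pose J2 : dform R n := fun=> - (n - k)%:R^-1 *: vavg D (contract D s).
pose J3 := contract D (fun=> k.+1%:R^-1 *: vavg D s).
have wIE : w \- I = v \- (J1 \- (J2 \- J3)).
  have kB y c c' : koszul y (c - c') = koszul y c - koszul y c'.
    by rewrite -scaleN1r koszulD koszulZ scaleN1r.
  apply/funext => x; rewrite /= /J1 /J2 /J3 [contract _ _ x]/contract /I /local_interp /v /=.
  rewrite csE vE sE pE scalerBr scalerA mulVf// scale1r kB scaleNr.
  set K := koszul _ b; set L := koszul _ _; set z := _ *: vavg D _; set W := vavg D w.
  by apply/ffunP => S; rewrite !ffunE; ring.
have lJ3 : l2form J3 by exact: (l2form_contract oD DM).
(* Includes j = 0, where the inverse is 0; this is the factor of J2 when k = n. *)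
have inv1 j : `|(j%:R : R)^-1| <= 1.
  case: j => [|j]; first by rewrite invr0 normr0.
  by rewrite normfV normr_nat invf_le1 ?ltr0n// ler1n.
have C0 := contract_bound_ge0.
have b1 : formsq J1 <= formsq v by exact: formsq_vavg.
have b2 : formsq J2 <= contract_bound M * formsq s.
  apply: le_trans (formsq_contract ls); apply: le_trans (formsq_vavg lcs).
  by apply: formsq_cstZ; rewrite normrN.
have b3 : formsq J3 <= contract_bound M * formsq s.
  apply: (le_trans (formsq_contract (lcst _))); rewrite ler_wpM2l//.
  apply: le_trans (formsq_vavg ls); exact: formsq_cstZ.
have lJ1 : l2form J1 := lcst _; have lJ2 : l2form J2 := lcst _.
have lJ23 : l2form (J2 \- J3) by exact: l2formB.
have lJ : l2form (J1 \- (J2 \- J3)) by exact: l2formB.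
have lsv : l2form (s \- (fun=> vavg D s)) by exact: l2formB.
have lwI : l2form (w \- I) by exact: l2formB.
rewrite !L2dot_formsq// wIE.
have h1 := formsqB lv lJ; have h2 := formsqB lJ1 lJ23; have h3 := formsqB lJ2 lJ3.
have h4 := formsqB ls (lcst (vavg D s)); have h5 := formsq_vavg ls.
rewrite /local_constant.
have s0 := formsq_ge0 s; have v0 := formsq_ge0 v.
have : 0 <= contract_bound M * formsq v by rewrite mulr_ge0.
rewrite -/v -/s => h6.
exact: interp_error_arith h1 h2 h3 h4 h5 b1 b2 b3 s0 v0 h6.
Qed.

End local_estimate.

(** * Barycentric coordinates and cells *)

Section barycentric.
Context (R : realType) (n : nat).
Implicit Types (T : 'M[R]_(n.+1, n)) (x : 'rV[R]_n).

Definition homog x : 'rV[R]_n.+1 := rV_cons (1, x).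

(** The leading column of ones turns the affine conditions sum l = 1, l T = x into one linear
    system, invertible exactly when the vertices are affinely independent. *)
Definition vertex_mx T : 'M[R]_n.+1 := row_mx (const_mx 1 : 'cV[R]_n.+1) T.

Definition bary T x : 'rV[R]_n.+1 := homog x *m invmx (vertex_mx T).

Lemma mul_vertex_mx (l : 'rV[R]_n.+1) T :
  l *m vertex_mx T = rV_cons (\sum_i l 0 i, l *m T).
Proof.
apply: etrans (mul_mx_row l (const_mx 1 : 'cV_n.+1) T) _; congr row_mx.
apply/rowP => i; rewrite !mxE (ord1 i) eqxx mulr1n; apply: eq_bigr => j _.
by rewrite mxE mulr1.
Qed.

Lemma vertex_mx_unit T : affinely_independent T -> vertex_mx T \in unitmx.
Proof.
move=> aT; rewrite unitmxE unitfE; apply/det0P => -[v v0]; rewrite mul_vertex_mx.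
move=> /(congr1 (@rV_uncons R n)); rewrite rV_consK => -[h1 h2].
move: v0; rewrite (aT v) ?eqxx//; first by rewrite h1 mxE.
by rewrite h2; apply/rowP => j; rewrite !mxE.
Qed.

Lemma baryK T x : affinely_independent T -> bary T x *m vertex_mx T = homog x.
Proof. by move=> aT; rewrite /bary mulmxKV// vertex_mx_unit. Qed.

Lemma sum_bary T x : affinely_independent T -> \sum_i bary T x 0 i = 1.
Proof.
move=> /(baryK x); rewrite mul_vertex_mx => /(congr1 (@rV_uncons R n)).
by rewrite !rV_consK => -[].
Qed.

Lemma bary_mul T x : affinely_independent T -> bary T x *m T = x.
Proof.
move=> /(baryK x); rewrite mul_vertex_mx => /(congr1 (@rV_uncons R n)).
by rewrite !rV_consK => -[].
Qed.

Lemma bary_eq T (l : 'rV[R]_n.+1) : affinely_independent T -> \sum_i l 0 i = 1 ->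
  bary T (l *m T) = l.
Proof.
move=> aT l1; rewrite /bary /homog -l1 -mul_vertex_mx mulmxK//.
exact: vertex_mx_unit.
Qed.

Lemma faceP T (A : {set 'I_n.+1}) x : affinely_independent T -> face T A x <->
  (forall i, 0 <= bary T x 0 i) /\ (forall i, i \notin A -> bary T x 0 i = 0).
Proof.
move=> aT; split; first by move=> [l [l0 lA l1 ->]]; rewrite bary_eq.
by move=> [h1 h2]; exists (bary T x); split => //; rewrite ?sum_bary ?bary_mul.
Qed.

Lemma hullP T x : affinely_independent T -> hull T x <-> forall i, 0 <= bary T x 0 i.
Proof.
move=> aT; rewrite /hull; split; first by move=> /(faceP _ _ aT)[].
by move=> h; apply/faceP => //; split => // i; rewrite inE.
Qed.

Definition bary_coef T i : 'rV[R]_n := \row_j invmx (vertex_mx T) (lift 0 j) i.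

Lemma bary_affine T x i :
  bary T x 0 i = \sum_j bary_coef T i 0 j * x 0 j + invmx (vertex_mx T) 0 i.
Proof.
rewrite /bary mxE big_ord_recl addrC; congr (_ + _); last by rewrite /homog rV_cons0 mul1r.
by apply: eq_bigr => j _; rewrite /homog rV_cons_lift mxE mulrC.
Qed.

Lemma bary_continuous T i : continuous (fun x => bary T x 0 i).
Proof.
under eq_fun do rewrite bary_affine.
exact: affine_continuous.
Qed.

(** The coefficients of this affine function form a column of an invertible matrix, so they do not
    all vanish. *)
Lemma bary_null T i : affinely_independent T ->
  lebesgue_rV R n [set x | bary T x 0 i = 0] = 0%E.
Proof.
move=> aT; have -> : [set x | bary T x 0 i = 0] =
    [set x : 'rV[R]_n | \sum_j bary_coef T i 0 j * x 0 j + invmx (vertex_mx T) 0 i = 0].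
  by apply/seteqP; split => x /=; rewrite bary_affine.
apply: hyperplane_null; rewrite -negb_and; apply/negP => /andP[/eqP c0 /eqP d0].
have := mulmxV (vertex_mx_unit aT) => /matrixP/(_ i i); rewrite !mxE eqxx big_ord_recl d0.
rewrite mulr0 add0r big1 => [/eqP|j _]; first by rewrite eq_sym oner_eq0.
by move/rowP: c0 => /(_ j); rewrite !mxE => ->; rewrite mulr0.
Qed.

(** The i-th coordinate is affine and equals 1 at vertex i, so if it is 0 at x it is negative beyond
    x on the ray from that vertex. *)
Lemma bary_ray T x (t : R) i : affinely_independent T ->
  bary T (x + t *: (x - row i T)) 0 i = bary T x 0 i + t * (bary T x 0 i - 1).
Proof.
move=> aT; have : bary T (row i T) 0 i = 1.
  rewrite rowE bary_eq//; first by rewrite mxE !eqxx.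
  by rewrite (bigD1 i)//= big1 => [|j ji]; rewrite mxE eqxx ?eqxx ?(negbTE ji) ?addr0.
rewrite !bary_affine => <-.
set d := invmx _ 0 i.
have -> : \sum_j bary_coef T i 0 j * (x + t *: (x - row i T)) 0 j =
    \sum_j bary_coef T i 0 j * x 0 j + t * (\sum_j bary_coef T i 0 j * x 0 j -
      \sum_j bary_coef T i 0 j * row i T 0 j).
  rewrite -sumrB mulr_sumr -big_split/=; apply: eq_bigr => j _.
  by rewrite !mxE; ring.
by ring.
Qed.

Lemma cellP T x : affinely_independent T -> cell T x <-> forall i, 0 < bary T x 0 i.
Proof.
move=> aT; split => [cx i|h]; last first.
  suff : \forall y \near x, forall i, 0 < bary T (y : 'rV[R]_n) 0 i.
    by apply: (@filterS _ (nbhs x)) => y hy; apply/hullP => // i; exact: ltW.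
  apply: (@filter_forall 'rV[R]_n 'I_n.+1 (fun i => [set y : 'rV[R]_n | 0 < bary T y 0 i]) (nbhs x)) => i.
  have hc : bary T y 0 i @[y --> x] --> bary T x 0 i by exact: bary_continuous.
  exact: cvgr_gt hc _ (h i).
have hx : hull T x by exact: interior_subset cx.
rewrite lt_def ((hullP _ aT).1 hx) andbT; apply/eqP => bi0.
(* Points of the ray slightly beyond x stay in the hull because x is interior, yet their i-th
   coordinate is negative. *)
have e0 : (fun t : R => x + t *: (x - row i T)) @ 0 --> (x : 'rV[R]_n).
  have e : x + 0 *: (x - row i T) = x by rewrite scale0r addr0.
  rewrite -[X in _ --> X]e.
  by apply: cvgD; [exact: cvg_cst|apply: cvgZr_tmp; exact: cvg_id].
have := e0 _ cx => /= /nbhs_ballP[e /= e_gt0 he].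
have he2 : ball (0 : R) e (e / 2).
  by rewrite /ball/= sub0r normrN gtr0_norm ?divr_gt0//; lra.
have := he _ he2 => /(hullP _ aT)/(_ i); rewrite bary_ray// bi0; lra.
Qed.

Lemma cell_open T : open (cell T).
Proof. exact: open_interior. Qed.

Lemma hull_cell_null T : affinely_independent T ->
  (lebesgue_rV R n).-negligible (hull T `\` cell T).
Proof.
move=> aT; have sub : hull T `\` cell T `<=` \bigcup_(k in [set: nat])
   (if insub k is Some i then [set x | bary T x 0 i = 0] else set0).
  move=> x [hx ncx]; have /existsNP[i] : ~ forall i, 0 < bary T x 0 i.
    by move=> h; apply: ncx; apply/cellP.
  move=> /negP; rewrite -leNgt => bi; exists (val i) => //; rewrite valK/=.
  by apply/eqP; rewrite eq_le bi ((hullP _ aT).1 hx).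
apply: negligibleS sub _; apply: negligible_bigcup => k.
case: insubP => [i _ _|_]; last exact: negligible_set0.
apply/negligibleP; last exact: bary_null.
have -> : [set x | bary T x 0 i = 0] =
    [set x : 'rV[R]_n | \sum_j bary_coef T i 0 j * x 0 j + invmx (vertex_mx T) 0 i = 0].
  by apply/seteqP; split => x /=; rewrite bary_affine.
exact: measurable_hyperplane.
Qed.

(** A common point would lie on a proper face of T, where some barycentric coordinate vanishes,
    whereas all are positive in the open cell. *)
Lemma cell_disjoint (Om : set 'rV[R]_n) (G : {fset 'M[R]_(n.+1, n)}) T T' x :
  simplicial_subdivision Om G -> T \in G -> T' \in G ->
  cell T x -> cell T' x -> T = T'.
Proof.
move=> [aG _ _ conf] TG TG' cx cx'; apply/eqP/negP => /negP TT'.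
have [A [B [pA _ hA _]]] := conf _ _ TG TG' TT'.
have : (hull T `&` hull T') x by split; exact: interior_subset.
rewrite hA => /(faceP _ _ (aG _ TG))[_ h].
move: pA; rewrite properT => /eqP; apply.
apply/setP => i; rewrite inE; apply/idPn => /h bi.
by have /(cellP _ (aG _ TG))/(_ i) := cx; rewrite bi ltxx.
Qed.

End barycentric.

(** * Sum over the cells *)

Section assembly.
Context (R : realType) (n : nat) (Om : set 'rV[R]_n) (oOm : open Om) (M : R).
Context (OmM : Om `<=` cbox (const_mx (- M)%R) (const_mx M)).
Context (G : {fset 'M[R]_(n.+1, n)}) (subG : simplicial_subdivision Om G).
Notation mu := (lebesgue_rV R n).
Implicit Types (T : 'M[R]_(n.+1, n)) (u v w p eta : dform R n) (S : {set 'I_n}).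

Lemma cell_cbox T : T \in G -> cell T `<=` cbox (const_mx (- M)%R) (const_mx M).
Proof. by move=> TG; apply: subset_trans OmM; have [_ _ + _] := subG; exact. Qed.

Lemma cellwise_eq (f : 'M[R]_(n.+1, n) -> dform R n) T x : T \in G -> cell T x -> cellwise G f x = f T x.
Proof.
move=> TG cx; rewrite /cellwise big_mkcond (bigD1_seq T) ?fset_uniq//=.
rewrite mem_set// big_seq_cond big1 ?addr0// => T' /andP[T'G T'T].
case: ifPn => // /set_mem cx'.
by move: T'T; rewrite (cell_disjoint subG T'G TG cx' cx) eqxx.
Qed.

Lemma cellwise_measurable (f : 'M[R]_(n.+1, n) -> dform R n) S :
  (forall T, T \in G -> measurable_fun (cell T) (fun x => f T x S)) ->
  measurable_fun Om (fun x => cellwise G f x S).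
Proof.
move=> mf; have mOm := rV_open_measurable oOm.
have -> : (fun x => cellwise G f x S) =
    (fun x => \sum_(T <- G) ((fun x => f T x S) \_ (cell T)) x).
  apply/funext => x; rewrite /cellwise sum_ffunE [LHS]big_mkcond.
  by apply: eq_bigr => T _; rewrite /patch.
have : forall T, T \in (G : seq _) -> measurable_fun Om ((fun x => f T x S) \_ (cell T)).
  move=> T TG; apply/measurable_restrict => //.
    by apply: rV_open_measurable; exact: cell_open.
  have [_ _ + _] := subG => /(_ T TG) TOm.
  by rewrite setIidr//; exact: mf.
elim: (G : seq _) => [|T s IHs] mT.
  by under eq_fun do rewrite big_nil; exact: measurable_cst.
under eq_fun do rewrite big_cons; apply: measurable_funD.
  by apply: mT; rewrite mem_head.
by apply: IHs => T' T's; apply: mT; rewrite inE T's orbT.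
Qed.

Lemma skeleton_null : mu.-negligible (Om `\` \big[setU/set0]_(T <- G) cell T).
Proof.
have [aG cG _ _] := subG.
pose N T := if T \in G then hull T `\` cell T else set0.
have sub : Om `\` \big[setU/set0]_(T <- G) cell T `<=` \bigcup_k N (nth 0 (G : seq _) k).
  move=> x [Ox nx]; have : closure Om x by exact: subset_closure.
  rewrite cG => -[T /= TG hx]; exists (index T (G : seq _)) => //.
  rewrite nth_index// /N TG; split => // cx; apply: nx.
  by rewrite -bigcup_seq; exists T.
apply: negligibleS sub _; apply: negligible_bigcup => k; rewrite /N.
case: ifPn => [TG|_]; last exact: negligible_set0.
by apply: hull_cell_null; exact: aG.
Qed.

(** Integrability is asked only cell by cell, as this is what is known of the piecewise derivative
    [d_h]. *)
Lemma L2dot_split v : (forall S, measurable_fun Om (fun x => v x S)) ->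
  (forall T, T \in G -> l2form (cell T) v) ->
  L2dot Om v v = \sum_(T <- G) L2dot (cell T) v v.
Proof.
move=> mv lv; have mOm := rV_open_measurable oOm.
have mC T : measurable (cell T) by apply: rV_open_measurable; exact: cell_open.
set U := \big[setU/set0]_(T <- G) cell T.
have mU : measurable U by apply: bigsetU_measurable.
have UOm : U `<=` Om.
  by rewrite /U -bigcup_seq => x [T TG cx]; have [_ _ + _] := subG => /(_ T TG); exact.
have mh : measurable_fun Om (fun x => cdot (v x) (v x)).
  by apply: measurable_sum => S; apply: measurable_funM.
have mN : measurable (Om `\` U) by exact: measurableD.
rewrite /L2dot /Rintegral.
have -> : (\int[mu]_(x in Om) (cdot (v x) (v x))%:E =
    \sum_(T <- G) \int[mu]_(x in cell T) (cdot (v x) (v x))%:E)%E.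
  rewrite -integral_bigsetU_EFin//; last 2 first.
  - move=> T T' /= TG T'G [x [cx cx']]; exact: (cell_disjoint subG TG T'G cx cx').
  - by apply/measurable_EFinP; apply: measurable_funS mh.
  rewrite -{1}(setDUK UOm) integral_setU//; last 2 first.
  - by rewrite setDUK//; apply/measurable_EFinP.
  - by apply/disj_setPS => x [Ux [_]].
  rewrite [X in (_ + X)%E]null_set_integral ?adde0//.
    by apply/measurable_EFinP; apply: measurable_funS mh.
  by apply: measure_negligible => //; exact: skeleton_null.
rewrite [RHS]big_seq sum_fine => [|T TG]; first by rewrite -big_seq.
apply: integrable_fin_num => //.
have := cdot_integrable (@cell_open R n T) (lv T TG) (lv T TG); exact.
Qed.

Definition cell_energy k T u : R :=
  L2dot (cell T) (d_on (cell T) k u) (d_on (cell T) k u) + L2dot (cell T) u u.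

Lemma eq_L2dot (D : set 'rV[R]_n) u v : (forall x, D x -> u x = v x) -> L2dot D u u = L2dot D v v.
Proof. by move=> uv; apply: eq_Rintegral => x; rewrite inE => Dx; rewrite uv. Qed.

Lemma eq_cell_energy k T u v : (forall x, cell T x -> u x = v x) ->
  cell_energy k T u = cell_energy k T v.
Proof.
by move=> uv; rewrite /cell_energy /d_on (weak_d_ext k uv) (eq_L2dot uv).
Qed.

Lemma dh_normE k u : (forall S, measurable_fun Om (fun x => u x S)) ->
  (forall T, T \in G -> l2form (cell T) u) ->
  (forall T, T \in G -> l2form (cell T) (d_on (cell T) k u)) ->
  dh_norm Om G k u = Num.sqrt (\sum_(T <- G) cell_energy k T u).
Proof.
move=> mu_ lu ld; rewrite /dh_norm /L2norm.
have ge0 v : 0 <= L2dot Om v v.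
  by apply: Rintegral_ge0 => x _; apply: sumr_ge0 => S _; exact: sqr_ge0.
rewrite !sqr_sqrtr//; congr Num.sqrt.
rewrite (L2dot_split mu_ lu) L2dot_split; last 2 first.
- by move=> S; apply: cellwise_measurable => T TG; exact: (ld T TG S).1.
- move=> T TG S; have := ld T TG S.
  suff h : forall x, cell T x -> d_h G k u x S = d_on (cell T) k u x S.
    move=> [md id]; split.
      by apply: eq_measurable_fun md => x; rewrite inE => cx; rewrite h.
    apply: eq_integrable id; first by apply: rV_open_measurable; exact: cell_open.
    by move=> x; rewrite inE => cx; rewrite h.
  by move=> x cx; rewrite /d_h (cellwise_eq _ TG cx).
rewrite -big_split/= big_seq [RHS]big_seq; apply: eq_bigr => T TG; congr (_ + _).
by apply: eq_L2dot => x cx; rewrite /d_h (cellwise_eq _ TG cx).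
Qed.

Lemma cell_estimate k T w p : (k <= n)%N -> T \in G -> Hform (cell T) k w -> P1m k p ->
  cell_energy k T (w \- interp (cell T) k w) <=
  local_constant n M * cell_energy k T (w \- p).
Proof.
move=> kn TG Hw Pp; have oT := @cell_open R n T; have TM := cell_cbox TG.
(* [avg] divides by the measure of the cell; on a null cell both energies
   vanish, so nonemptiness of the cells is not needed. *)
have [m0|m0] := eqVneq (fine (mu (cell T))) 0; last first.
  by apply: (local_interp_estimate oT TM) => //; exact: (interpE oT TM).
have [Lw [t wt]] := Hw; have mT := rV_open_measurable oT.
have zero q : P1m k q -> cell_energy k T (w \- q) = 0.
  move=> Pq; have [t' wt'] := weak_d_sub_P1m oT TM Lw wt Pq.
  have [wd _] := d_onP oT TM wt'.
  have [_ sq] := P1m_L2form oT TM Pq.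
  have null v : l2form (cell T) v -> L2dot (cell T) v v = 0.
    move=> lv; rewrite /L2dot /Rintegral null_set_integral//.
    - exact: (measurable_int mu (cdot_integrable oT lv lv)).
    - have /fineK h : mu (cell T) \is a fin_num.
        by rewrite ge0_fin_numE; [exact: (open_fin oT TM)|].
      by apply: etrans (esym h) _; rewrite m0.
  rewrite /cell_energy !null ?addr0//; last exact: (L2form_l2 wd.1).
  apply: (l2formB oT); first exact: (L2form_l2 Lw).
  exact: (smooth_l2form oT TM).
by rewrite !zero ?mulr0//; exact: interp_P1m.
Qed.

Lemma energy_regularity k T w p : T \in G -> Hform (cell T) k w -> P1m k p ->
  l2form (cell T) (w \- p) /\ l2form (cell T) (d_on (cell T) k (w \- p)).
Proof.
move=> TG [Lw [t wt]] Pp; have oT := @cell_open R n T; have TM := cell_cbox TG.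
have [t' wt'] := weak_d_sub_P1m oT TM Lw wt Pp.
have [wd _] := d_onP oT TM wt'; split; last exact: (L2form_l2 wd.1).
apply: (l2formB oT); first exact: (L2form_l2 Lw).
by apply: (smooth_l2form oT TM); have [] := P1m_L2form oT TM Pp.
Qed.

(** Applied to both the interpolant and a competitor. The form eta agrees with q T only inside the
    cells, which determine the norm. *)
Lemma dh_norm_piecewise k w eta q : L2form Om k w ->
  (forall T, T \in G -> Hform (cell T) k w) ->
  (forall S, measurable_fun Om (fun x => eta x S)) ->
  (forall T, T \in G -> P1m k (q T) /\ forall x, cell T x -> eta x = q T x) ->
  dh_norm Om G k (w \- eta) = Num.sqrt (\sum_(T <- G) cell_energy k T (w \- q T)).
Proof.
move=> Lw Hw meta hq.
have eqT T x : T \in G -> cell T x -> (w \- eta) x = (w \- q T) x.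
  by move=> TG cx /=; rewrite (hq T TG).2.
rewrite dh_normE.
- by congr Num.sqrt; rewrite big_seq [RHS]big_seq; apply: eq_bigr => T TG; apply: eq_cell_energy => x; exact: eqT.
- move=> S; have [mw _] := Lw.2 S.
  have -> : (fun x => (w \- eta) x S) = (fun x => w x S) \- (fun x => eta x S).
    by apply/funext => x; rewrite /= !ffunE.
  exact: measurable_funB.
- move=> T TG S; have [lq _] := energy_regularity TG (Hw T TG) (hq T TG).1.
  have [ml il] := lq S; split.
    by apply: eq_measurable_fun ml => x; rewrite inE => cx; rewrite (eqT T).
  apply: eq_integrable il; first by apply: rV_open_measurable; exact: cell_open.
  by move=> x; rewrite inE => cx; rewrite (eqT T).
- move=> T TG; have [_] := energy_regularity TG (Hw T TG) (hq T TG).1.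
  by rewrite /d_on (weak_d_ext k (fun x cx => eqT T x TG cx)).
Qed.

Lemma quasi_optimal k w eta : (k <= n)%N -> L2form Om k w ->
  (forall T, T \in G -> Hform (cell T) k w) -> P1m_h Om G k eta ->
  dh_norm Om G k (w \- interp_h G k w) <=
  Num.sqrt (local_constant n M) * dh_norm Om G k (w \- eta).
Proof.
move=> kn Lw Hw [Leta Peta].
have /choice[q hq] : forall T, exists p, T \in G -> P1m k p /\ forall x, cell T x -> eta x = p x.
  move=> T; have [TG|TG] := boolP (T \in G); last by exists eta.
  have [p Pp ep] := Peta T TG; exists p => _; split => // x cx; apply: ep.
  by rewrite inE.
rewrite (dh_norm_piecewise (eta := eta) (q := q) Lw Hw) => [|S|T TG]; [|by have [] := Leta.2 S|exact: hq].
rewrite (dh_norm_piecewise (eta := interp_h G k w) (q := fun T => interp (cell T) k w) Lw Hw); last 2 first.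
- move=> S; apply: cellwise_measurable => T TG.
  have [_ s] := P1m_L2form (@cell_open R n T) (cell_cbox TG) (interp_P1m (cell T) k w).
  exact: (smooth_l2 (@cell_open R n T) (cell_cbox TG) (s S)).1.
- move=> T TG; split; first exact: interp_P1m.
  by move=> x cx; rewrite /interp_h (cellwise_eq _ TG cx).
have C0 : 0 <= local_constant n M.
  by rewrite /local_constant addr_ge0// mulr_ge0// contract_bound_ge0.
(* The local constant is the same on every cell, so it survives the summation of squares. *)
rewrite -sqrtrM// ler_wsqrtr// mulr_sumr big_seq [leRHS]big_seq.
by apply: ler_sum => T TG; apply: cell_estimate => //; [exact: Hw|exact: (hq T TG).1].
Qed.

End assembly.

(** * The uniform constant and the infimum *)

Lemma bounded_set_cbox (R : realType) n (A : set 'rV[R]_n) : bounded_set A ->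
  exists M : R, A `<=` cbox (const_mx (- M)%R) (const_mx M).
Proof.
move=> [M [_ HM]]; exists (M + 1) => x Ax i; rewrite !mxE -ler_norml.
have xM : `|x| <= M + 1 by apply: HM Ax; rewrite ltrDl.
apply: le_trans xM; rewrite [leRHS]mx_normrE.
exact: (le_bigmax _ (fun ij => `|x ij.1 ij.2|) (0, i)).
Qed.

Theorem lemma3p5 (R : realType) (n k : nat) (Om : set 'rV[R]_n)
    (F : set {fset 'M[R]_(n.+1, n)}) :
  (1 <= n)%N -> (k <= n)%N ->
  polyhedral_domain Om ->
  (forall G, F G -> simplicial_subdivision Om G) ->
  shape_regular F ->
  exists C : R, forall G, F G -> forall w : dform R n,
    L2form Om k w -> (forall T, T \in G -> Hform (cell T) k w) ->
    dh_norm Om G k (w \- interp_h G k w) <=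
    C * inf [set dh_norm Om G k (w \- eta) | eta in P1m_h Om G k].
Proof.
move=> _ kn [_ oOm _ bOm _] subF _.
have [M OmM] := bounded_set_cbox bOm.
exists (Num.sqrt (local_constant n M)) => G FG w Lw Hw.
have C0 : 0 < Num.sqrt (local_constant n M).
  rewrite sqrtr_gt0 /local_constant.
  by have := contract_bound_ge0 n M; lra.
(* Dividing by the positive constant reduces the claim to a lower bound on the set of errors, which
   is nonempty by the competitor eta = 0. *)
rewrite -ler_pdivrMl//; apply: lb_le_inf => [|_ [eta Peta <-]].
  exists (dh_norm Om G k (w \- (fun=> 0))), (fun=> 0) => //; split.
    by apply: (cst_L2form oOm OmM) => S _; rewrite ffunE.
  move=> T TG; exists (fun=> 0) => //.
  exists 0, 0; split; [by move=> S _; rewrite ffunE|by move=> S _; rewrite ffunE|].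
  apply/funext => x; rewrite add0r; apply/ffunP => S; rewrite !ffunE big1// => i _.
  by rewrite ffunE mulr0.
rewrite ler_pdivrMl//.
by apply: (quasi_optimal oOm OmM (subF _ FG)).
Qed.
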